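(* Assume $p=p_n\to\infty$ as $n\to\infty$. Define $$\overline{C}_{\min}=\frac{1}{\alpha_nt_n}\left\{\cos(\Theta_{\min})-\sqrt{1-t_n^2}\right\}+\ln\big[(p_n-1)(1-t_n^2)\big]$$ and $$\overline{C}_{\max}=\frac{1}{\alpha_nt_n}\left\{\cos(\Theta_{\max})+\sqrt{1-t_n^2}\right\}-\ln\big[(p_n-1)(1-t_n^2)\big].$$ Then $\overline{C}_{\min}$ and $\overline{C}_{\max}$ are asymptotically independent and $(\overline{C}_{\min},\overline{C}_{\max})$ converges jointly in distribution, as $n\to\infty$, to $(-Z_1,Z_2)$, where $Z_1$ and $Z_2$ are independent random variables, each with cumulative distribution function $$D(x)=1-\exp\left\{-\frac{1}{2\sqrt{2\pi}}e^{x/2}\right\},\qquad x\in\mathbb{R}.$$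
   Context: For each $n\ge 2$ let $p=p_n\ge 2$ be an integer and let $X_1,\ldots,X_n$ be i.i.d. random vectors uniformly distributed on the unit sphere $\mathbb S^{p-1}=\{x\in\mathbb R^p:\|x\|=1\}$ (Euclidean norm). Define $\Theta_{ij}=\arccos(X_i^TX_j)\in[0,\pi]$ for $1\le i<j\le n$, and $\Theta_{\min}=\min_{1\le i<j\le n}\Theta_{ij}$, $\Theta_{\max}=\max_{1\le i<j\le n}\Theta_{ij}$. Set $$t_n=\exp\left\{-\frac{2\ln n}{p_n-1}\right\}\in(0,1),\qquad \alpha_n=\frac{t_n}{2(p_n-1)\sqrt{1-t_n^2}}.$$ Asymptotic independence means that the limit in distribution of the pair has independent components. *)

(* Defs.v *)
From mathcomp Require Import all_boot all_order all_algebra.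
From mathcomp Require Import all_classical all_reals all_analysis.
Set Implicit Arguments.
Unset Strict Implicit.
Unset Printing Implicit Defensive.
Import Order.TTheory GRing.Theory Num.Theory.
Import numFieldNormedType.Exports.
Local Open Scope classical_set_scope.
Local Open Scope ring_scope.

(* Vectors of R^p are tuples [p.-tuple R]: the sigma-algebra that the library
   puts on tuples is the product of the Borel sigma-algebras of R, i.e. the
   Borel sigma-algebra of R^p. *)

Definition dotp (R : realType) (p : nat) (x y : p.-tuple R) : R :=
  \sum_(k < p) tnth x k * tnth y k.

Definition enorm (R : realType) (p : nat) (x : p.-tuple R) : R :=
  Num.sqrt (dotp x x).

Definition unit_sphere (R : realType) (p : nat) : set (p.-tuple R) :=
  [set x | enorm x = 1].

Definition mxact (R : realType) (p : nat) (A : 'M[R]_p) (x : p.-tuple R) :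
  p.-tuple R := [tuple \sum_(j < p) A i j * tnth x j | i < p].

Definition orthogonal_mx (R : realType) (p : nat) (A : 'M[R]_p) : Prop :=
  A *m A^T = 1%:M.

(* The uniform distribution on the sphere is the (unique) Borel probability
   measure carried by the sphere and invariant under the orthogonal group. *)
Definition uniform_on_sphere (R : realType) (p : nat)
    (mu : probability (p.-tuple R) R) : Prop :=
  mu (@unit_sphere R p) = 1%E /\
  forall A : 'M[R]_p, orthogonal_mx A ->
  forall B : set (p.-tuple R), measurable B -> mu (mxact A @^-1` B) = mu B.

Definition mutually_independent (R : realType) (d d' : measure_display)
    (T : measurableType d) (T' : measurableType d') (P : probability T R)
    (I : finType) (X : I -> {RV P >-> T'}) : Prop :=
  forall (J : {set I}) (B : I -> set T'), (forall i, measurable (B i)) ->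
    (P (\bigcap_(i in [set` J]) (X i @^-1` B i)) =
     \prod_(i in J) P (X i @^-1` B i))%E.

Definition independent2 (R : realType) (d : measure_display)
    (T : measurableType d) (P : probability T R) (U V : {RV P >-> R}) : Prop :=
  forall A B : set R, measurable A -> measurable B ->
    (P (U @^-1` A `&` V @^-1` B) = P (U @^-1` A) * P (V @^-1` B))%E.

Definition joint_cdf (R : realType) (d : measure_display)
    (T : measurableType d) (P : probability T R) (U V : T -> R)
    (z : R * R) : R :=
  fine (P [set w | U w <= z.1 /\ V w <= z.2]).

Definition cvg_in_distribution2 (R : realType)
    (d : nat -> measure_display) (T : forall n, measurableType (d n))
    (P : forall n, probability (T n) R) (U V : forall n, T n -> R)
    (d' : measure_display) (S : measurableType d') (Q : probability S R)
    (U' V' : S -> R) : Prop :=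
  forall z : R * R, {for z, continuous (joint_cdf Q U' V')} ->
    joint_cdf (P n) (U n) (V n) z @[n --> \oo] --> joint_cdf Q U' V' z.

Definition asymptotically_independent (R : realType)
    (d : nat -> measure_display) (T : forall n, measurableType (d n))
    (P : forall n, probability (T n) R) (U V : forall n, T n -> R) : Prop :=
  exists (d' : measure_display) (S : measurableType d')
    (Q : probability S R) (U' V' : {RV Q >-> R}),
    independent2 U' V' /\ cvg_in_distribution2 P U V Q U' V'.

Definition angle (R : realType) (p : nat) (x y : p.-tuple R) : R :=
  acos (dotp x y).

(* For n >= 2 the index set is nonempty, and the default values pi and 0 are
   neutral because the angles between unit vectors lie in [0, pi]. *)
Definition Theta_min (R : realType) (n p : nat) (x : 'I_n -> p.-tuple R) : R :=
  \big[Num.min/pi]_(ij : 'I_n * 'I_n | (ij.1 < ij.2)%N)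
     angle (x ij.1) (x ij.2).

Definition Theta_max (R : realType) (n p : nat) (x : 'I_n -> p.-tuple R) : R :=
  \big[Num.max/0]_(ij : 'I_n * 'I_n | (ij.1 < ij.2)%N)
     angle (x ij.1) (x ij.2).

Definition t_ (R : realType) (n p : nat) : R :=
  expR (- (2 * ln n%:R / (p%:R - 1))).

Definition alpha_ (R : realType) (n p : nat) : R :=
  t_ R n p / (2 * (p%:R - 1) * Num.sqrt (1 - t_ R n p ^+ 2)).

Definition C_min (R : realType) (n p : nat) (x : 'I_n -> p.-tuple R) : R :=
  1 / (alpha_ R n p * t_ R n p)
    * (cos (Theta_min x) - Num.sqrt (1 - t_ R n p ^+ 2))
  + ln ((p%:R - 1) * (1 - t_ R n p ^+ 2)).

Definition C_max (R : realType) (n p : nat) (x : 'I_n -> p.-tuple R) : R :=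
  1 / (alpha_ R n p * t_ R n p)
    * (cos (Theta_max x) + Num.sqrt (1 - t_ R n p ^+ 2))
  - ln ((p%:R - 1) * (1 - t_ R n p ^+ 2)).

Definition D_cdf (R : realType) (x : R) : R :=
  1 - expR (- (1 / (2 * Num.sqrt (2 * pi)) * expR (x / 2))).

(* Main.v *)
(** Invariance of the uniform law under reflections gives Stein's identity
    (p - 1) E[f(y_i) y_i] = E[f'(y_i) (1 - y_i^2)].  For f a clamp it becomes a
    differential inequality for the truncated moment H(s) = E[y_i; y_i > s], whose
    solution is H(s) = H(0) (1 - s^2)^((p - 1) / 2); since E[y_i^2] = 1 / p,
    Wallis' integrals give 2 pi p H(0)^2 -> 1.  The bounds
    (H(s) - H(s')) / s' <= P(y_i > s) <= H(s) / s then yield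
    n^2 P(y_i > s_n(z)) -> exp(-z / 2) / sqrt(2 pi) at the thresholds s_n(z) given by
    the normalisation of the theorem.
    For i <> j the scalar product of X_i and X_j is independent of (X_k)_{k <> j}.
    Adding the vectors one at a time and applying Bonferroni's inequalities to the
    pairs created by the last one, the probability that no pair has its scalar
    product in A is exp(- q n (n - 1) / 2) + O(n^3 q^2), where q is the probability
    that a given pair does.  The joint distribution function is the difference of
    these probabilities for A = (s, oo) and for the union of (s, oo) with
    (-oo, -s']. *)
Require Import Defs.
From HB Require Import structures.
From mathcomp Require Import all_boot all_order all_algebra.
From mathcomp Require Import all_classical all_reals all_analysis.
From mathcomp Require Import measurable_realfun ring lra.
Import Order.TTheory GRing.Theory Num.Theory.
Import numFieldNormedType.Exports.
Local Open Scope classical_set_scope.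
Local Open Scope ring_scope.
Set Implicit Arguments.
Unset Strict Implicit.
Unset Printing Implicit Defensive.

(** The uniform law is given by its invariance alone, without a density, so every integral has to
    come from a reflection. The truncated moment is treated before the tail because Stein's identity
    closes on it: H' = - (p - 1) s / (1 - s^2) H involves no other unknown function. The
    normalisation can be read off the solution. Since t_n^(2 (p - 1)) = n^(-4), the closed form at s
    = sqrt(1 - t_n^2) is of order H(0) n^(-2). Dividing by s then costs a factor sqrt K with K = (p
    - 1) (1 - t_n^2), and the logarithm in the normalisation restores it. The scalar products are
    not mutually independent. It is enough that the product of X_i with a new vector is independent
    of the configuration already present, and that two products sharing a vector are independent: as
    q is of order n^(-2), the error n^3 q^2 is of order 1 / n. The two limits are independent
    because the rates of the two disjoint tails add up and the exponential of a sum factors. *)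

(** * Bounded measurable functions *)

Section bounded_measurable.
Context d (T : measurableType d) (R : realType) (P : probability T R).
Context (D : set T) (mD : measurable D).

(** Boundedness is asked on [D] only: coordinates are bounded on the sphere but not on the whole
    space. *)
Definition bounded_measurable (f : T -> R) :=
  measurable_fun setT f /\ exists M, forall x, D x -> `|f x| <= M.

Lemma bounded_measurable_integrable f :
  bounded_measurable f -> P.-integrable D (EFin \o f).
Proof.
move=> [mf [M fM]]; apply: measurable_bounded_integrable => //.
- by rewrite (le_lt_trans (probability_le1 P mD)) ?ltry.
- exact: measurable_funTS.
- by exists M; split; rewrite ?num_real// => x Mx y Dy; exact: le_trans (fM _ Dy) (ltW Mx).
Qed.

Lemma bounded_measurable_cst (c : R) : bounded_measurable (fun=> c).
Proof. by split; [exact: measurable_cst|exists `|c|]. Qed.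

Lemma bounded_measurableD f g : bounded_measurable f -> bounded_measurable g ->
  bounded_measurable (fun x => f x + g x).
Proof.
move=> [mf [M fM]] [mg [N gN]]; split; first exact: measurable_funD.
by exists (M + N) => x Dx; rewrite (le_trans (ler_normD _ _))// lerD ?fM ?gN.
Qed.

Lemma bounded_measurableM f g : bounded_measurable f -> bounded_measurable g ->
  bounded_measurable (fun x => f x * g x).
Proof.
move=> [mf [M fM]] [mg [N gN]]; split; first exact: measurable_funM.
by exists (M * N) => x Dx; rewrite normrM ler_pM ?fM ?gN.
Qed.

Lemma bounded_measurableB f g : bounded_measurable f -> bounded_measurable g ->
  bounded_measurable (fun x => f x - g x).
Proof.
move=> bf bg; under eq_fun do rewrite -mulN1r.
exact/bounded_measurableD/bounded_measurableM/bg/bounded_measurable_cst.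
Qed.

Lemma bounded_measurable_sum (I : Type) (s : seq I) (J : {pred I})
    (f : I -> T -> R) : (forall i, bounded_measurable (f i)) ->
  bounded_measurable (fun x => \sum_(i <- s | J i) f i x).
Proof.
move=> bf; elim: s => [|i s IH].
  by under eq_fun do rewrite big_nil; exact: bounded_measurable_cst.
under eq_fun do rewrite big_cons; case: (J i) => //.
exact: bounded_measurableD.
Qed.

Lemma bounded_measurable_comp f (g : R -> R) M : measurable_fun setT g ->
  measurable_fun setT f -> (forall x, D x -> `|g (f x)| <= M) ->
  bounded_measurable (fun x => g (f x)).
Proof. by move=> mg mf gM; split; [exact: measurableT_comp|exists M]. Qed.

Lemma bounded_measurable_bool (b : T -> bool) : measurable_fun setT b ->
  bounded_measurable (fun x => (b x)%:R).
Proof.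
move=> mb; split.
  by apply: (measurableT_comp (f := fun c : bool => c%:R : R)) => // ? ? ?.
by exists 1 => x _; case: (b x); rewrite ?normr1// normr0.
Qed.

Lemma Rintegral_sum (I : Type) (s : seq I) (J : {pred I}) (f : I -> T -> R) :
  (forall i, bounded_measurable (f i)) ->
  \int[P]_(x in D) (\sum_(i <- s | J i) f i x) =
  \sum_(i <- s | J i) \int[P]_(x in D) f i x.
Proof.
move=> bf; elim: s => [|i s IH].
  rewrite big_nil; under eq_Rintegral do rewrite big_nil.
  by rewrite Rintegral_cst// mul0r.
rewrite big_cons; under eq_Rintegral do rewrite big_cons.
case: (J i) => //; rewrite RintegralD ?IH//; apply: bounded_measurable_integrable => //.
exact: bounded_measurable_sum.
Qed.

Lemma ler_bounded_Rintegral f g : bounded_measurable f -> bounded_measurable g ->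
  (forall x, D x -> f x <= g x) -> \int[P]_(x in D) f x <= \int[P]_(x in D) g x.
Proof.
by move=> bf bg fg; apply: le_Rintegral => //; exact: bounded_measurable_integrable.
Qed.

End bounded_measurable.

(** * Reflections of the sphere *)

Section sphere.
Context (R : realType) (p : nat).
Implicit Types (x y w : p.-tuple R).

Lemma measurable_tnthr (i : 'I_p) :
  measurable_fun setT (fun y : p.-tuple R => tnth y i).
Proof. exact: measurable_tnth. Qed.

Lemma measurable_dotp d (T : measurableType d) (f g : T -> p.-tuple R) :
  measurable_fun setT f -> measurable_fun setT g ->
  measurable_fun setT (fun t => dotp (f t) (g t)).
Proof.
move=> mf mg; apply: measurable_sum => i; apply: measurable_funM.
  exact: measurableT_comp (measurable_tnthr i) mf.
exact: measurableT_comp (measurable_tnthr i) mg.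
Qed.

Lemma dotpp_ge0 x : 0 <= dotp x x.
Proof. by apply: sumr_ge0 => i _; rewrite -expr2 sqr_ge0. Qed.

Lemma dotpC x y : dotp x y = dotp y x.
Proof. by apply: eq_bigr => i _; rewrite mulrC. Qed.

Lemma unit_sphereE : @unit_sphere R p = [set y | dotp y y = 1].
Proof.
apply/seteqP; split => y; rewrite /unit_sphere/= /enorm.
  by move=> /(congr1 (fun r => r ^+ 2)); rewrite sqr_sqrtr ?dotpp_ge0// expr1n.
by move=> ->; rewrite sqrtr1.
Qed.

Lemma measurable_unit_sphere : measurable (@unit_sphere R p).
Proof.
rewrite unit_sphereE (_ : mkset _ = (fun y => dotp y y) @^-1` [set 1])//.
by rewrite -[X in measurable X]setTI; apply: measurable_dotp => //; exact: measurable_id.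
Qed.

Lemma tnth_sqr_le1 y i : unit_sphere y -> tnth y i ^+ 2 <= 1.
Proof.
rewrite unit_sphereE/= => <-; rewrite /dotp (bigD1 i)//= expr2 lerDl.
by apply: sumr_ge0 => j _; rewrite -expr2 sqr_ge0.
Qed.

Lemma tnth_normr_le1 y i : unit_sphere y -> `|tnth y i| <= 1.
Proof.
by move=> /tnth_sqr_le1-/(_ i); rewrite -[leLHS]real_normK ?num_real// expr_le1.
Qed.

Lemma sum_tnth_sqr y i : unit_sphere y ->
  \sum_(j | j != i) tnth y j ^+ 2 = 1 - tnth y i ^+ 2.
Proof.
rewrite unit_sphereE/= => <-; rewrite /dotp [in RHS](bigD1 i)//= -expr2 [RHS]addrAC subrr add0r.
by apply: eq_bigr => j _; rewrite expr2.
Qed.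

(* For [w = 0] this is the identity, since division by zero gives zero. *)
Definition reflection w y : p.-tuple R :=
  [tuple tnth y i - 2 * dotp w y / dotp w w * tnth w i | i < p].

Definition reflection_mx w : 'M[R]_p :=
  \matrix_(i, j) ((i == j)%:R - 2 / dotp w w * (tnth w i * tnth w j)).

Lemma mxact_reflection w : mxact (reflection_mx w) = reflection w.
Proof.
apply/funext => y; apply: eq_from_tnth => i; rewrite !tnth_mktuple.
under eq_bigr do rewrite mxE mulrBl.
rewrite big_split/= (bigD1 i)//= eqxx mul1r big1 ?addr0; last first.
  by move=> j /negbTE; rewrite eq_sym => ->; rewrite mul0r.
congr (_ + _); rewrite sumrN; congr (- _).
set c := (dotp w w)^-1; have -> : 2 * dotp w y * c * tnth w i = 2 * c * tnth w i * dotp w y by ring.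
rewrite mulr_sumr.
by apply: eq_bigr => j _; ring.
Qed.

(** With v the column of coordinates of w, the matrix is 1 - c v v^T for c = 2 / <w, w>; it is
    symmetric, and v^T v = <w, w> makes it an involution. *)
Lemma orthogonal_reflection_mx w : orthogonal_mx (reflection_mx w).
Proof.
have [w0|w0] := eqVneq (dotp w w) 0.
  rewrite /orthogonal_mx (_ : reflection_mx w = 1%:M) ?trmx1 ?mulmx1//.
  by apply/matrixP => i j; rewrite !mxE w0 invr0 mulr0 mul0r subr0.
pose v : 'cV[R]_p := \col_i tnth w i; pose c := 2 / dotp w w.
have -> : reflection_mx w = 1%:M - c *: (v *m v^T).
  by apply/matrixP => i j; rewrite !mxE big_ord1 !mxE.
have vv : v^T *m v = (dotp w w)%:M.
  rewrite [LHS]mx11_scalar !mxE; congr (_%:M).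
  by apply: eq_bigr => i _; rewrite !mxE.
have sym : (1%:M - c *: (v *m v^T))^T = 1%:M - c *: (v *m v^T).
  by apply/matrixP => i j; rewrite !mxE !big_ord1 !mxE eq_sym (mulrC (tnth w i)).
rewrite /orthogonal_mx sym.
rewrite mulmxBl mul1mx mulmxBr mulmx1 -scalemxAl -scalemxAr.
rewrite -mulmxA (mulmxA v^T) vv mul_scalar_mx -scalemxAr !scalerA.
rewrite /c divfK// -/c mulr_natr mulr2n scalerDl opprB.
by rewrite addrK subrK.
Qed.

Lemma tnth_reflection w y i :
  tnth (reflection w y) i = tnth y i - 2 * dotp w y / dotp w w * tnth w i.
Proof. by rewrite tnth_mktuple. Qed.

Lemma dotp_reflection w y : dotp (reflection w y) (reflection w y) = dotp y y.
Proof.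
have [w0|w0] := eqVneq (dotp w w) 0.
  by congr (dotp _ _); apply: eq_from_tnth => i;
    rewrite tnth_reflection w0 invr0 mulr0 mul0r subr0.
set c := 2 * dotp w y / dotp w w.
transitivity (dotp y y - 2 * c * dotp w y + c ^+ 2 * dotp w w).
  rewrite /dotp !mulr_sumr -sumrN -!big_split/=.
  by apply: eq_bigr => i _; rewrite tnth_reflection -/c; ring.
by rewrite /c; field.
Qed.

Lemma measurable_reflection w : measurable_fun setT (reflection w).
Proof.
apply/measurable_fun_tnthP => i.
rewrite [X in measurable_fun _ X](_ : _ = fun y =>
  tnth y i - 2 / dotp w w * tnth w i * dotp w y); last first.
  by apply/funext => y /=; rewrite tnth_reflection; ring.
apply: measurable_funB; first exact: measurable_tnthr.
apply: measurable_funM => //; apply: measurable_dotp => //.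
Qed.

Lemma reflection_sphere w : reflection w @^-1` @unit_sphere R p = @unit_sphere R p.
Proof. by rewrite unit_sphereE; apply/seteqP; split=> y /=; rewrite dotp_reflection. Qed.

Section uniform.
Variables (nu : probability (p.-tuple R) R) (nu_unif : uniform_on_sphere nu).
Local Notation bounded := (bounded_measurable (@unit_sphere R p)).
Local Notation "'Ex' f" := (\int[nu]_(y in @unit_sphere R p) f y) (at level 10, f at level 8).

(** Invariance on sets passes to integrals by a change of variables; the domain does not move
    because a reflection preserves the sphere. *)
Lemma reflection_invariance w f : bounded f -> Ex (f \o reflection w) = Ex f.
Proof.
move=> bf; rewrite /Rintegral; congr fine.
have mf : measurable_fun setT (EFin \o f) by apply/measurable_EFinP; case: bf.
have intf : nu.-integrable (reflection w @^-1` @unit_sphere R p)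
    ((EFin \o f) \o reflection w).
  rewrite reflection_sphere.
  apply: (@bounded_measurable_integrable _ _ _ nu _ _ (f \o reflection w)).
    exact: measurable_unit_sphere.
  case: bf => mf' [M fM]; split; first exact: measurableT_comp mf' (measurable_reflection w).
  exists M => y Sy; apply: fM.
  by have : (reflection w @^-1` @unit_sphere R p) y by rewrite reflection_sphere.
have := integral_pushforward (measurable_reflection w) mf intf measurable_unit_sphere.
rewrite reflection_sphere => <-; apply: eq_measure_integral; first exact: measurable_reflection.
move=> ? A mA _.
by have := nu_unif.2 _ (orthogonal_reflection_mx w) A mA; rewrite mxact_reflection.
Qed.

End uniform.
End sphere.

Ltac bounded_measurability := repeat first
  [ assumption | exact: bounded_measurable_cst
  | apply: bounded_measurableB | apply: bounded_measurableD
  | apply: bounded_measurableM ].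

(** * Stein's inequality for one coordinate *)

Section stein.
Context (R : realType) (p : nat).
Variables (nu : probability (p.-tuple R) R) (nu_unif : uniform_on_sphere nu).
Local Notation S := (@unit_sphere R p).
Local Notation bounded := (bounded_measurable S).
Local Notation "'Ex' f" := (\int[nu]_(y in S) f y) (at level 10, f at level 8).

Let mS : measurable S := @measurable_unit_sphere R p.
Let integrable_bounded := @bounded_measurable_integrable _ _ _ nu _ mS.

Lemma bounded_tnth i : bounded (fun y => tnth y i).
Proof.
by split; [exact: measurable_tnthr|exists 1 => y; exact: tnth_normr_le1].
Qed.

Lemma mass_unit_sphere : fine (nu S) = 1.
Proof. by rewrite nu_unif.1. Qed.

Lemma Rintegral_sphere_cst (c : R) : \int[nu]_(y in S) c = c.
Proof. by rewrite Rintegral_cst// mass_unit_sphere mulr1. Qed.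

Lemma bounded_lipschitz_comp (f : R -> R) (L : R) (h : p.-tuple R -> R) :
  measurable_fun setT f -> (forall x y, `|f x - f y| <= L * `|x - y|) ->
  bounded h -> bounded (fun y => f (h y)).
Proof.
move=> mf fL [mh [M hM]].
have L0 : 0 <= L by have := le_trans (normr_ge0 _) (fL 1 0); rewrite subr0 normr1 mulr1.
apply: (@bounded_measurable_comp _ _ _ _ _ _ (`|f 0| + L * M)) => // y Sy.
rewrite -[f _](subrK (f 0)) addrC (le_trans (ler_normD _ _))// lerD2l.
by rewrite (le_trans (fL _ _))// subr0 ler_wpM2l// hM.
Qed.

Section pair.
Variables (i j : 'I_p) (ij : j != i).

Let ej : p.-tuple R := [tuple (k == j)%:R | k < p].

(** The reflection along the j-th basis vector flips y_j and fixes y_i, so the integral equals its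
    opposite. *)
Lemma expectation_odd (h : R -> R) : bounded (fun y => h (tnth y i)) ->
  \int[nu]_(y in S) (h (tnth y i) * tnth y j) = 0.
Proof.
move=> bh; have bj := bounded_tnth j.
have bhj : bounded (fun y => h (tnth y i) * tnth y j) by bounded_measurability.
have dej y : dotp ej y = tnth y j.
  rewrite /dotp (bigD1 j)//= tnth_mktuple eqxx mul1r big1 ?addr0// => k /negbTE kj.
  by rewrite tnth_mktuple kj mul0r.
have := reflection_invariance nu_unif ej bhj.
rewrite (@eq_Rintegral _ _ _ _ _ (fun y => -1 * (h (tnth y i) * tnth y j))); last first.
  move=> y _ /=; rewrite !tnth_reflection !dej !tnth_mktuple eqxx.
  rewrite eq_sym (negbTE ij) divr1 mulr0 subr0 mulr1n; ring.
by rewrite RintegralZl ?integrable_bounded// => ?; lra.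
Qed.

(** This is [expectation_odd] transported by the reflection along t e_i - e_j, under which the
    coordinates i and j become c y_i + s y_j and s y_i - c y_j. Here (c, s) is the rational
    parametrisation of the circle by the tangent of the half angle. *)
Lemma expectation_rotation (f : R -> R) (t : R) :
  let c := (1 - t ^+ 2) / (1 + t ^+ 2) in let s := 2 * t / (1 + t ^+ 2) in
  bounded (fun y => f (tnth y i)) ->
  \int[nu]_(y in S) (f (c * tnth y i + s * tnth y j) *
    (s * tnth y i - c * tnth y j)) = 0.
Proof.
move=> c s bf; have bj := bounded_tnth j.
have bfj : bounded (fun y => f (tnth y i) * tnth y j) by bounded_measurability.
have t0 : 1 + t ^+ 2 != 0 by rewrite gt_eqF// ltr_pwDl// sqr_ge0.
pose w : p.-tuple R := [tuple (if k == i then t else if k == j then -1 else 0) | k < p].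
have dw y : dotp w y = t * tnth y i - tnth y j.
  rewrite /dotp (bigD1 i)//= (bigD1 j)//= !tnth_mktuple !eqxx (negbTE ij).
  rewrite big1 ?addr0 ?mulN1r// => k /andP[/negbTE ki /negbTE kj].
  by rewrite tnth_mktuple ki kj mul0r.
rewrite -(expectation_odd bf) -(reflection_invariance nu_unif w bfj).
apply: eq_Rintegral => y _ /=; rewrite !tnth_reflection !dw !tnth_mktuple !eqxx (negbTE ij).
have -> : t * t - -1 = 1 + t ^+ 2 by ring.
congr (f _ * _); rewrite /c /s; by field.
Qed.

(* [g u] bounds the slopes of [f] in a neighbourhood of [u] whose size does not
   depend on [u], so that no derivative of [f] is needed. *)
Lemma stein_pair (f g : R -> R) (L G delta : R) :
  measurable_fun setT f -> (forall x y, `|f x - f y| <= L * `|x - y|) ->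
  measurable_fun setT g -> (forall x, `|g x| <= G) -> 0 < delta ->
  (forall u x y, `|u| <= 1 -> `|x - u| <= delta -> `|y - u| <= delta -> x <= y ->
     f y - f x <= g u * (y - x)) ->
  \int[nu]_(y in S) (f (tnth y i) * tnth y i) <=
  \int[nu]_(y in S) (g (tnth y i) * tnth y j ^+ 2).
Proof.
move=> mf fL mg gG d0 fg.
have L0 : 0 <= L by have := le_trans (normr_ge0 _) (fL 1 0); rewrite subr0 normr1 mulr1.
have G0 : 0 <= G by exact: le_trans (normr_ge0 _) (gG 0).
have [bi bj] := (bounded_tnth i, bounded_tnth j).
have bg : bounded (fun y => g (tnth y i)).
  by apply: (@bounded_measurable_comp _ _ _ _ _ _ G) => //; exact: measurable_tnthr.
have bf h : bounded h -> bounded (fun y => f (h y)) by exact: bounded_lipschitz_comp fL.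
have bfi := bf _ bi.
apply/ler_addgt0Pr => e e0.
(* The points c u and c u + s v at which f is evaluated are within [4 * t] of u, and the total error
   [K] below is at most e. *)
pose t := Num.min 1 (Num.min (delta / 4) (e / (4 * L + 2 * G + 1))).
have K0 : 0 < 4 * L + 2 * G + 1 by lra.
have t0 : 0 < t by rewrite /t !lt_min ltr01/= !divr_gt0.
have t1 : t <= 1 by rewrite /t ge_min lexx.
have td : 4 * t <= delta.
  by rewrite mulrC -ler_pdivlMr// /t !ge_min lexx orbT.
have te : (4 * L + 2 * G + 1) * t <= e.
  by rewrite mulrC -ler_pdivlMr// /t !ge_min lexx !orbT.
have := @expectation_rotation f t bfi.
set c := (1 - t ^+ 2) / (1 + t ^+ 2); set s := 2 * t / (1 + t ^+ 2) => /= Q0.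
have s0 : 0 < s by rewrite /s divr_gt0// ?mulr_gt0// ltr_pwDl// sqr_ge0.
have s2 : s <= 2 * t.
  by rewrite /s ler_pdivrMr ?ltr_pwDl ?sqr_ge0// ler_peMr ?lerDl ?sqr_ge0 ?mulr_ge0// ltW.
have c1E : 1 - c = s * t by rewrite /c /s; field; rewrite gt_eqF// ltr_pwDl// sqr_ge0.
have st2 : s * t <= 2 * t by nra.
have st0 : 0 <= s * t by nra.
have c0 : 0 <= c.
  by apply: divr_ge0; [rewrite subr_ge0 exprn_ile1// ltW|rewrite addr_ge0 ?sqr_ge0].
clearbody c s; clearbody t.
pose K := L * (4 * t) + G * (2 * t).
have bfr := bf (fun y => c * tnth y i + s * tnth y j).
have {}bfr : bounded (fun y => f (c * tnth y i + s * tnth y j)).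
  by apply: bfr; bounded_measurability.
have bfc : bounded (fun y => f (c * tnth y i)) by apply: bf; bounded_measurability.
(* The added term vanishes by oddness in y_j. It turns the part in - c v into an increment of f, of
   order s; dividing by s and letting t tend to 0 would give E[f(u) u] = E[f'(u) v^2]. *)
have E0 : \int[nu]_(y in S) (f (c * tnth y i + s * tnth y j) *
    (s * tnth y i - c * tnth y j) + c * (f (c * tnth y i) * tnth y j)) = 0.
  rewrite RintegralD// ?Q0 ?RintegralZl// ?add0r; last 3 first.
  - by apply: integrable_bounded; bounded_measurability.
  - by apply: integrable_bounded; bounded_measurability.
  - by apply: integrable_bounded; bounded_measurability.
  by rewrite (@expectation_odd (fun u => f (c * u)))// mulr0.
have : \int[nu]_(y in S) (s * (f (tnth y i) * tnth y i - g (tnth y i) * tnth y j ^+ 2 - K)) <= 0.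
  rewrite -E0; apply: ler_bounded_Rintegral => //; try by bounded_measurability.
  move=> y Sy.
  have := tnth_normr_le1 i Sy; have := tnth_normr_le1 j Sy.
  move: (tnth y i) (tnth y j) => u v v1 u1.
  have near_u : `|c * u + s * v - u| <= 4 * t.
    have -> : c * u + s * v - u = s * v - (s * t) * u by rewrite -c1E; ring.
    rewrite (le_trans (ler_normB _ _))// !normrM (gtr0_norm s0) (gtr0_norm t0).
    have : s * `|v| <= s * 1 by rewrite ler_pM2l.
    have : s * t * `|u| <= s * t * 1 by rewrite ler_wpM2l.
    lra.
  have near_c : `|c * u - u| <= 4 * t.
    have -> : c * u - u = - (s * t * u) by rewrite -c1E; ring.
    rewrite normrN !normrM (gtr0_norm s0) (gtr0_norm t0).
    have : s * t * `|u| <= s * t * 1 by rewrite ler_wpM2l.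
    lra.
  (* The order of c u and c u + s v depends on the sign of v; multiplying the slope bound by v gives
     the same inequality in both cases. *)
  have A : (f (c * u + s * v) - f (c * u)) * v <= s * (g u * v ^+ 2).
    have [v0|v0] := leP 0 v.
      have sv : c * u <= c * u + s * v by rewrite lerDl mulr_ge0// ltW.
      have := fg _ _ _ u1 (le_trans near_c td) (le_trans near_u td) sv; nra.
    have sv : c * u + s * v <= c * u by nra.
    have := fg _ _ _ u1 (le_trans near_u td) (le_trans near_c td) sv; nra.
  have B : f u * u - L * (4 * t) <= f (c * u + s * v) * u.
    have := fL u (c * u + s * v); rewrite distrC => fuL.
    have {fuL} : `|(f u - f (c * u + s * v)) * u| <= L * (4 * t).
      by rewrite normrM -[leRHS]mulr1 ler_pM// distrC (le_trans fuL)// ler_wpM2l// distrC.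
    rewrite ler_norml => /andP[_]; lra.
  have C : - ((1 - c) * (s * (g u * v ^+ 2))) <= s * (G * (2 * t)).
    have gv : `|g u * v ^+ 2| <= G.
      by rewrite normrM -[leRHS]mulr1 ler_pM// normrX exprn_ile1.
    have gv1 : 0 <= G + g u * v ^+ 2 by move: gv; rewrite ler_norml; lra.
    have := mulr_ge0 (ltW s0) (mulr_ge0 gv1 st0).
    have : 0 <= s * (G * (2 * t - s * t)) by rewrite !mulr_ge0 ?subr_ge0// ltW.
    rewrite c1E; lra.
  have := ler_wpM2l c0 A; have := ler_wpM2l (ltW s0) B; rewrite /K; lra.
rewrite RintegralZl//; last by apply: integrable_bounded; bounded_measurability.
rewrite RintegralB//; [|by apply: integrable_bounded; bounded_measurability..].
rewrite RintegralB//; [|by apply: integrable_bounded; bounded_measurability..].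
rewrite Rintegral_sphere_cst pmulr_rle0//.
move: te; rewrite /K; lra.
Qed.

End pair.

(** Sum of [stein_pair] over the p - 1 indices j other than i, whose squared coordinates add up to 1
    - y_i^2. The reverse inequality is obtained by applying this one to - f. *)
Lemma stein_inequality (i : 'I_p) (f g : R -> R) (L G delta : R) :
  measurable_fun setT f -> (forall x y, `|f x - f y| <= L * `|x - y|) ->
  measurable_fun setT g -> (forall x, `|g x| <= G) -> 0 < delta ->
  (forall u x y, `|u| <= 1 -> `|x - u| <= delta -> `|y - u| <= delta -> x <= y ->
     f y - f x <= g u * (y - x)) ->
  p.-1%:R * \int[nu]_(y in S) (f (tnth y i) * tnth y i) <=
  \int[nu]_(y in S) (g (tnth y i) * (1 - tnth y i ^+ 2)).
Proof.
move=> mf fL mg gG d0 fg.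
have bg : bounded (fun y => g (tnth y i)).
  by apply: (@bounded_measurable_comp _ _ _ _ _ _ G) => //; exact: measurable_tnthr.
have -> : \int[nu]_(y in S) (g (tnth y i) * (1 - tnth y i ^+ 2)) =
    \sum_(j | j != i) \int[nu]_(y in S) (g (tnth y i) * tnth y j ^+ 2).
  rewrite -Rintegral_sum//; last first.
    by move=> j; have bj := bounded_tnth j; bounded_measurability.
  apply: eq_Rintegral => y; rewrite inE => Sy.
  by rewrite -mulr_sumr sum_tnth_sqr.
have -> : p.-1 = #|[pred j : 'I_p | j != i]|.
  by have := cardC1 i; rewrite card_ord => <-; apply: eq_card => j; rewrite !inE.
rewrite -sum1_card natr_sum mulr_suml; apply: ler_sum => j ji.
by rewrite mul1r; apply: stein_pair fg.
Qed.

End stein.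

(** * The truncated moment *)

Section cap_moment.
Context (R : realType) (p : nat).
Variables (nu : probability (p.-tuple R) R) (nu_unif : uniform_on_sphere nu).
Variable i : 'I_p.
Local Notation S := (@unit_sphere R p).
Local Notation bounded := (bounded_measurable S).

Let mS : measurable S := @measurable_unit_sphere R p.
Let integrable_bounded := @bounded_measurable_integrable _ _ _ nu _ mS.
Let bi : bounded (fun y => tnth y i) := @bounded_tnth R p i.

Definition cap_moment (s : R) := \int[nu]_(y in S) ((s < tnth y i)%R%:R * tnth y i).

Local Notation H := cap_moment.

Lemma bounded_lt_tnth s : bounded (fun y => (s < tnth y i)%R%:R : R).
Proof.
apply: bounded_measurable_bool; apply: measurable_fun_ltr => //.
exact: measurable_tnthr.
Qed.

Lemma cap_moment_ge0 s : 0 <= s -> 0 <= H s.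
Proof.
move=> s0; apply: Rintegral_ge0 => y _; case: ltP => [sy|_]; last by rewrite mul0r.
by rewrite mul1r (le_trans s0)// ltW.
Qed.

Lemma cap_momentB a b : H a - H b =
  \int[nu]_(y in S) (((a < tnth y i)%R%:R - (b < tnth y i)%R%:R) * tnth y i).
Proof.
have [ba bb] := (bounded_lt_tnth a, bounded_lt_tnth b).
rewrite -RintegralB//; [|by apply: integrable_bounded; bounded_measurability..].
by apply: eq_Rintegral => y _; rewrite mulrBl.
Qed.

Lemma cap_moment_le a b : 0 <= a -> a <= b -> H b <= H a.
Proof.
move=> a0 ab; rewrite -subr_ge0 cap_momentB; apply: Rintegral_ge0 => y _.
have [ay|ya] := ltP a (tnth y i); have [by_|yb] := ltP b (tnth y i) => /=.
- by rewrite subrr mul0r.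
- by rewrite subr0 mul1r; lra.
- by lra.
- by rewrite subrr mul0r.
Qed.

Lemma cap_moment_le1 a : 0 <= a -> H a <= 1.
Proof.
move=> a0; rewrite -(Rintegral_sphere_cst nu_unif 1).
have ba := bounded_lt_tnth a.
apply: ler_bounded_Rintegral => //; first by bounded_measurability.
  exact: bounded_measurable_cst.
move=> y Sy; have := tnth_normr_le1 i Sy; rewrite ler_norml => /andP[_ y1].
by case: ltP => _; rewrite ?mul1r ?mul0r.
Qed.

(** Values of y_i in (0, a] contribute at most a. Continuity at 0 is obtained in this separate way
    because the slope bounds below divide by a. *)
Lemma cap_moment_ge_sub a : 0 <= a -> H 0 - a <= H a.
Proof.
move=> a0; rewrite lerBlDr -lerBlDl cap_momentB -[leRHS](Rintegral_sphere_cst nu_unif).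
have [ba b0] := (bounded_lt_tnth a, bounded_lt_tnth 0).
apply: ler_bounded_Rintegral => //; first by bounded_measurability.
  exact: bounded_measurable_cst.
move=> y _; have [y0|y0] := ltP 0 (tnth y i); have [ay|ya] := ltP a (tnth y i) => /=.
- by rewrite subrr mul0r.
- by rewrite subr0 mul1r.
- by lra.
- by rewrite subrr mul0r.
Qed.

Section slopes.
(* [clamp c e] is [0] up to [c], has slope [1] on [[c, e]] and is constant
   afterwards. *)
Let clamp (c e x : R) := Num.max 0 (Num.min (x - c) (e - c)).

Let measurable_clamp c e : measurable_fun setT (clamp c e).
Proof.
apply: measurable_maxr => //; apply: measurable_minr => //.
by apply: measurable_funB => //.
Qed.

Let clampP (c e x : R) : c <= e ->
  [\/ x <= c /\ clamp c e x = 0, [/\ c <= x, x <= e & clamp c e x = x - c] |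
      e <= x /\ clamp c e x = e - c].
Proof.
move=> ce; rewrite /clamp; have [xc|/ltW cx] := leP x c.
  by constructor 1; split => //; case: (leP (x - c) (e - c)) => ?; case: leP => ?; lra.
have [xe|/ltW ex] := leP x e; [constructor 2|constructor 3]; split => //;
  by case: (leP (x - c) (e - c)) => ?; case: leP => ?; lra.
Qed.

Let clamp_lipschitz c e x y : c <= e ->
  `|clamp c e x - clamp c e y| <= 1 * `|x - y|.
Proof.
move=> ce; rewrite mul1r; have [xy|xy] := leP x y.
  have xy0 : x - y <= 0 by rewrite subr_le0.
  rewrite (ler0_norm xy0) ler_norml.
  case: (clampP x ce) => [[? ->]|[? ? ->]|[? ->]];
    case: (clampP y ce) => [[? ->]|[? ? ->]|[? ->]]; lra.
have xy0 : 0 <= x - y by rewrite subr_ge0 ltW.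
rewrite (ger0_norm xy0) ler_norml.
case: (clampP x ce) => [[? ->]|[? ? ->]|[? ->]];
  case: (clampP y ce) => [[? ->]|[? ? ->]|[? ->]]; lra.
Qed.

Let indic (c e x : R) : R := ((c <= x)%R && (x <= e)%R)%:R.

Let measurable_indic_itv c e : measurable_fun setT (indic c e).
Proof.
apply: (measurableT_comp (f := fun c : bool => c%:R : R)) => [? ? ?//|].
by apply: measurable_and; apply: measurable_fun_ler => //.
Qed.

Let indic_le1 c e x : `|indic c e x| <= 1.
Proof. by rewrite /indic; case: (_ && _); rewrite ?normr1 ?normr0. Qed.

Let bounded_indic c e : bounded (fun y => indic c e (tnth y i)).
Proof.
apply: (@bounded_measurable_comp _ _ _ _ _ _ 1) => //; exact: measurable_tnthr.
Qed.

Let bounded_clamp c e : c <= e -> bounded (fun y => clamp c e (tnth y i)).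
Proof.
by move=> ce; apply: (@bounded_lipschitz_comp _ _ _ 1) => // x y; exact: clamp_lipschitz.
Qed.

Let stein_upper c e delta : c <= e -> 0 < delta ->
  p.-1%:R * \int[nu]_(y in S) (clamp c e (tnth y i) * tnth y i) <=
  \int[nu]_(y in S) (indic (c - delta) (e + delta) (tnth y i) * (1 - tnth y i ^+ 2)).
Proof.
move=> ce d0; apply: (@stein_inequality _ _ _ nu_unif i (clamp c e)
  (indic (c - delta) (e + delta)) 1 1 delta) => //.
  by move=> x y; exact: clamp_lipschitz.
move=> u x y _; rewrite !ler_norml => /andP[x1 x2] /andP[y1 y2] xy.
rewrite /indic.
have [cu|uc] := leP (c - delta) u; have [ue|eu] := leP u (e + delta) => /=;
  case: (clampP x ce) => [[? ->]|[? ? ->]|[? ->]];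
  case: (clampP y ce) => [[? ->]|[? ? ->]|[? ->]]; lra.
Qed.

Let stein_lower c e delta : c <= e -> 0 < delta ->
  \int[nu]_(y in S) (indic (c + delta) (e - delta) (tnth y i) * (1 - tnth y i ^+ 2)) <=
  p.-1%:R * \int[nu]_(y in S) (clamp c e (tnth y i) * tnth y i).
Proof.
move=> ce d0.
have bc := bounded_clamp ce; have bn := bounded_indic (c + delta) (e - delta).
have := @stein_inequality _ _ _ nu_unif i (fun x => -1 * clamp c e x)
  (fun x => -1 * indic (c + delta) (e - delta) x) 1 1 delta.
have -> : \int[nu]_(y in S) (-1 * clamp c e (tnth y i) * tnth y i) =
    -1 * \int[nu]_(y in S) (clamp c e (tnth y i) * tnth y i).
  rewrite -RintegralZl//; last by apply: integrable_bounded; bounded_measurability.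
  by apply: eq_Rintegral => y _; rewrite mulrA.
have -> : \int[nu]_(y in S) (-1 * indic (c + delta) (e - delta) (tnth y i) *
      (1 - tnth y i ^+ 2)) =
    -1 * \int[nu]_(y in S) (indic (c + delta) (e - delta) (tnth y i) *
      (1 - tnth y i ^+ 2)).
  rewrite -RintegralZl//; last by apply: integrable_bounded; bounded_measurability.
  by apply: eq_Rintegral => y _; rewrite mulrA.
rewrite mulrCA !mulN1r lerN2; apply => //.
- by apply: measurable_funM.
- move=> x y; rewrite -mulrBr normrM normrN1 (mul1r `|clamp _ _ _ - _|).
  exact: clamp_lipschitz.
- by apply: measurable_funM.
- by move=> x; rewrite normrM normrN1 mul1r.
- move=> u x y _; rewrite !ler_norml => /andP[x1 x2] /andP[y1 y2] xy.
  rewrite /indic.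
  have [cu|uc] := leP (c + delta) u; have [ue|eu] := leP u (e - delta) => /=;
    case: (clampP x ce) => [[? ->]|[? ? ->]|[? ->]];
    case: (clampP y ce) => [[? ->]|[? ? ->]|[? ->]]; lra.
Qed.

(** A clamp rising inside (a, b) is about b - a beyond b, and its slope lives where 1 - u^2 <= u (1
    - a^2) / a, because (1 - u^2) / u decreases. *)
Lemma cap_moment_slope_upper a b : 0 < a -> a < b -> b < 1 ->
  p.-1%:R * (b - a) * H b <= (1 - a ^+ 2) / a * (H a - H b).
Proof.
move=> a0 ab b1; have Hb0 : 0 <= H b by rewrite cap_moment_ge0// ltW// (lt_trans a0).
apply/ler_addgt0Pr => e e0.
pose m : R := p.-1%:R; have m0 : 0 <= m by exact: ler0n.
pose delta := Num.min ((b - a) / 4) (e / (3 * m * H b + 1)).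
have K0 : 0 < 3 * m * H b + 1 by rewrite ltr_wpDl// !mulr_ge0.
have d0 : 0 < delta by rewrite /delta lt_min !divr_gt0// subr_gt0.
have dab : 4 * delta <= b - a by rewrite mulrC -ler_pdivlMr// /delta ge_min lexx.
have de : (3 * m * H b + 1) * delta <= e.
  by rewrite mulrC -ler_pdivlMr// /delta ge_min lexx orbT.
clearbody delta.
(* With these margins the widened indicator sits on [a + delta, b], inside the set a < u <= b that H
   a - H b counts. *)
have ce : a + 2 * delta <= b - delta by lra.
have := stein_upper ce d0.
have -> : a + 2 * delta - delta = a + delta by ring.
rewrite subrK -/m.
have [bHb bi1] := (bounded_lt_tnth b, bounded_indic (a + delta) b).
have [bHa bc] := (bounded_lt_tnth a, bounded_clamp ce).
have lower : (b - a - 3 * delta) * H b <=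
    \int[nu]_(y in S) (clamp (a + 2 * delta) (b - delta) (tnth y i) * tnth y i).
  rewrite -RintegralZl//; last by apply: integrable_bounded; bounded_measurability.
  apply: ler_bounded_Rintegral => //; [by bounded_measurability..|] => y _.
  move: (tnth y i) => u; have [bu|ub] := ltP b u => /=.
    rewrite mul1r; case: (clampP u ce) => [[? ->]|[? ? ->]|[? ->]]; [lra|lra|].
    by rewrite le_eqVlt; apply/orP; left; apply/eqP; ring.
  rewrite mul0r mulr0; case: (clampP u ce) => [[? ->]|[? ? ->]|[? ->]].
  - by rewrite mul0r.
  - by rewrite mulr_ge0//; lra.
  - by rewrite mulr_ge0//; lra.
have upper : \int[nu]_(y in S) (indic (a + delta) b (tnth y i) * (1 - tnth y i ^+ 2)) <=
    (1 - a ^+ 2) / a * (H a - H b).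
  rewrite cap_momentB -RintegralZl//; last by apply: integrable_bounded; bounded_measurability.
  apply: ler_bounded_Rintegral => //; [by bounded_measurability..|] => y _.
  rewrite /indic; move: (tnth y i) => u.
  have a1 : 0 <= (1 - a ^+ 2) / a.
    by rewrite divr_ge0 ?ltW// subr_gt0 exprn_ilt1// ?ltW// (lt_trans ab).
  have [au|ua] := leP (a + delta) u => /=; have [bu|ub] := ltP b u => /=.
  - have -> : (a < u)%R by lra.
    by rewrite /= subrr !mul0r mulr0.
  - have -> : (a < u)%R by lra.
    rewrite /= subr0 !mul1r mulrAC ler_pdivlMr//.
    have : 0 <= u * a by rewrite mulr_ge0 ?ltW//; lra.
    have : 0 <= u - a by lra.
    nra.
  - by lra.
  - rewrite mul0r subr0; case: ltP => ? /=; last by rewrite mul0r mulr0.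
    by rewrite mul1r mulr_ge0//; lra.
have := ler_wpM2l m0 lower; move=> h1 h2.
have : m * ((b - a - 3 * delta) * H b) <= (1 - a ^+ 2) / a * (H a - H b).
  by rewrite (le_trans h1)// (le_trans h2).
have mHd : 0 <= m * H b * delta by rewrite !mulr_ge0// ltW.
lra.
Qed.

(** Here the clamp starts at a - delta, so H (a - delta) appears, which is not yet known to be close
    to H a. The auxiliary point a0 < a bounds it until continuity is available. *)
Lemma cap_moment_slope_lower_lt a0 a b : 0 < a0 -> a0 < a -> a < b -> b < 1 ->
  (1 - b ^+ 2) / b * (H a - H b) <= p.-1%:R * (b - a) * H a0.
Proof.
move=> a00 a0a ab b1; have Ha0 : 0 <= H a0 by rewrite cap_moment_ge0// ltW.
have b0 : 0 < b by lra.
apply/ler_addgt0Pr => eps e0.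
pose m : R := p.-1%:R; have m0 : 0 <= m by exact: ler0n.
pose delta := Num.min (a - a0) (eps / (2 * m * H a0 + 1)).
have K0 : 0 < 2 * m * H a0 + 1 by rewrite ltr_wpDl// !mulr_ge0.
have d0 : 0 < delta by rewrite /delta lt_min !divr_gt0// subr_gt0 a0a.
have dab : delta <= a - a0 by rewrite /delta ge_min lexx.
have de : (2 * m * H a0 + 1) * delta <= eps.
  by rewrite mulrC -ler_pdivlMr// /delta ge_min lexx orbT.
clearbody delta.
have ce : a - delta <= b + delta by lra.
have := stein_lower ce d0; rewrite subrK addrK -/m.
have [bHb bi1] := (bounded_lt_tnth b, bounded_indic a b).
have [bHa bc] := (bounded_lt_tnth a, bounded_clamp ce).
have bHd := bounded_lt_tnth (a - delta).
have upper : \int[nu]_(y in S) (clamp (a - delta) (b + delta) (tnth y i) * tnth y i) <=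
    (b - a + 2 * delta) * H (a - delta).
  rewrite -RintegralZl//; last by apply: integrable_bounded; bounded_measurability.
  apply: ler_bounded_Rintegral => //; [by bounded_measurability..|] => y _.
  move: (tnth y i) => u; have [bu|ub] := ltP (a - delta) u => /=; last first.
    by case: (clampP u ce) => [[? ->]|[? ? ->]|[? ->]]; nra.
  rewrite mul1r; have u0 : 0 <= u by lra.
  by rewrite ler_wpM2r//; case: (clampP u ce) => [[? ->]|[? ? ->]|[? ->]]; lra.
have lower : (1 - b ^+ 2) / b * (H a - H b) <=
    \int[nu]_(y in S) (indic a b (tnth y i) * (1 - tnth y i ^+ 2)).
  rewrite cap_momentB -RintegralZl//; last by apply: integrable_bounded; bounded_measurability.
  apply: ler_bounded_Rintegral => //; [by bounded_measurability..|] => y Sy.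
  have := tnth_sqr_le1 i Sy; rewrite /indic; move: (tnth y i) => u u1.
  have [au|ua] := ltP a u => /=; have [bu|ub] := ltP b u => /=.
  - by rewrite andbF/= subrr !mul0r mulr0.
  - rewrite (ltW au)/= subr0 !mul1r mulrAC ler_pdivrMr//.
    have : 0 <= u * b by rewrite mulr_ge0 ?ltW//; lra.
    have : 0 <= b - u by lra.
    nra.
  - by lra.
  - by rewrite subrr mul0r mulr0 mulr_ge0// subr_ge0.
have Hd : H (a - delta) <= H a0 by rewrite cap_moment_le//; lra.
move=> h1; rewrite (le_trans lower)// (le_trans h1)//.
have := ler_wpM2l m0 upper.
have : m * (b - a + 2 * delta) * H (a - delta) <= m * (b - a + 2 * delta) * H a0.
  by rewrite ler_wpM2l// mulr_ge0//; lra.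
lra.
Qed.

(** The weak slope bound with H <= 1 already gives a Lipschitz constant on (0, B]. Letting a0 tend
    to a then yields the sharp bound [cap_moment_slope_lower]. *)
Lemma cap_moment_continuous_upto (B : R) : 0 < B -> B < 1 ->
  exists2 C, 0 <= C & forall a b, 0 < a -> a <= b -> b <= B -> H a - H b <= C * (b - a).
Proof.
move=> B0 B1; exists (p.-1%:R / ((1 - B ^+ 2) / B)).
  by rewrite divr_ge0// divr_ge0 ?ltW// subr_gt0 exprn_ilt1// ltW.
move=> a b a0; rewrite le_eqVlt => /predU1P[<-|ab] bB; first by rewrite !subrr mulr0.
have h : (1 - b ^+ 2) / b * (H a - H b) <= p.-1%:R * (b - a).
  apply: le_trans (cap_moment_slope_lower_lt (a0 := a / 2) _ _ ab _) _ => //; try lra.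
  have m0 : 0 <= p.-1%:R * (b - a) by rewrite mulr_ge0// subr_ge0 ltW.
  by rewrite -[leRHS]mulr1 ler_wpM2l// cap_moment_le1// divr_ge0// ltW.
have k : (1 - B ^+ 2) / B <= (1 - b ^+ 2) / b.
  have b0 : 0 < b by lra.
  rewrite ler_pdivrMr// mulrAC ler_pdivlMr//.
  have : 0 <= B * b by rewrite ltW// mulr_gt0.
  have : 0 <= B - b by lra.
  nra.
have HH : 0 <= H a - H b by rewrite subr_ge0 cap_moment_le ?ltW.
rewrite mulrAC ler_pdivlMr; last by rewrite divr_gt0// subr_gt0 exprn_ilt1// ltW.
by rewrite mulrC (le_trans _ h)// ler_wpM2r.
Qed.

Lemma cap_moment_slope_lower a b : 0 < a -> a < b -> b < 1 ->
  (1 - b ^+ 2) / b * (H a - H b) <= p.-1%:R * (b - a) * H a.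
Proof.
move=> a0 ab b1; have [C C0 CH] := cap_moment_continuous_upto (lt_trans a0 ab) b1.
apply/ler_addgt0Pr => e e0.
pose K := p.-1%:R * (b - a) * C.
have K0 : 0 <= K by rewrite !mulr_ge0// subr_ge0 ltW.
pose d := Num.min (a / 2) (e / (K + 1)).
have d0 : 0 < d by rewrite /d lt_min !divr_gt0// ltr_wpDl.
have da : d <= a / 2 by rewrite /d ge_min lexx.
have de : (K + 1) * d <= e.
  by rewrite mulrC -ler_pdivlMr ?ltr_wpDl// /d ge_min lexx orbT.
clearbody d.
have h1 : 0 < a - d by lra.
have h2 : a - d < a by lra.
apply: (le_trans (cap_moment_slope_lower_lt h1 h2 ab b1)).
have := CH _ _ h1 (ltW h2) (ltW ab).
have m0 : 0 <= p.-1%:R * (b - a) by rewrite mulr_ge0// subr_ge0 ltW.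
move=> /(ler_wpM2l m0); have : 0 <= K * d by rewrite mulr_ge0// ltW.
move: de; rewrite /K; lra.
Qed.

End slopes.
End cap_moment.

(** * The differential equation of the truncated moment and its solution *)

Section cap_moment_closed_form.
Context (R : realType) (p : nat).
Variables (nu : probability (p.-tuple R) R) (nu_unif : uniform_on_sphere nu).
Variable i : 'I_p.
Local Notation H := (cap_moment nu i).
Let m : R := p.-1%:R.
Let m0 : 0 <= m. Proof. exact: ler0n. Qed.

Let phi (x : R) := x / (1 - x ^+ 2).

Let one_subX_gt0 (x : R) : 0 < x -> x < 1 -> 0 < 1 - x ^+ 2.
Proof. by move=> x0 x1; rewrite subr_gt0 exprn_ilt1// ltW. Qed.

Let cap_moment_slopes a b : 0 < a -> a < b -> b < 1 ->
  m * phi a * H b * (b - a) <= H a - H b <= m * phi b * H a * (b - a).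
Proof.
move=> a0 ab b1; have b0 := lt_trans a0 ab; have a1 := lt_trans ab b1.
have := cap_moment_slope_upper nu_unif i a0 ab b1.
have := cap_moment_slope_lower nu_unif i a0 ab b1.
rewrite -/m /phi; have [wa wb] := (one_subX_gt0 a0 a1, one_subX_gt0 b0 b1).
rewrite mulrAC ler_pdivrMr// => h1; rewrite [leRHS]mulrAC ler_pdivlMr// => h2; apply/andP; split.
  have -> : m * (a / (1 - a ^+ 2)) * H b * (b - a) =
    m * (b - a) * H b * a / (1 - a ^+ 2) by ring.
  by rewrite ler_pdivrMr// (le_trans h2)// mulrC.
have -> : m * (b / (1 - b ^+ 2)) * H a * (b - a) =
    m * (b - a) * H a * b / (1 - b ^+ 2) by ring.
by rewrite ler_pdivlMr// mulrC.
Qed.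

(** The quotient is squeezed between values of - m phi H in which phi and H are taken at different
    endpoints; moving both to x costs the variations of phi and of H. *)
Let cap_moment_quotient x y : 0 < x < 1 -> 0 < y < 1 -> x != y ->
  `|(H y - H x) / (y - x) + m * phi x * H x| <=
  m * `|phi y - phi x| + m * phi x * `|H y - H x|.
Proof.
move=> /andP[x0 x1] /andP[y0 y1] xy.
have H0 z : 0 < z -> 0 <= H z by move=> z0; rewrite cap_moment_ge0// ltW.
have H1 z : 0 < z -> H z <= 1 by move=> z0; rewrite cap_moment_le1// ltW.
have phi0 z : 0 < z -> z < 1 -> 0 <= phi z.
  by move=> z0 z1; rewrite divr_ge0// ltW// one_subX_gt0.
have [hx hy] := (mulr_ge0 m0 (phi0 _ x0 x1), mulr_ge0 m0 (phi0 _ y0 y1)).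
suff : - (m * `|phi y - phi x| * H x) - m * phi x * `|H y - H x| <=
    (H y - H x) / (y - x) + m * phi x * H x <=
    m * `|phi y - phi x| * H x + m * phi x * `|H y - H x|.
  have : m * `|phi y - phi x| * H x <= m * `|phi y - phi x| * 1.
    by rewrite ler_wpM2l ?mulr_ge0 ?H1.
  by move=> ? ?; rewrite ler_norml; lra.
have Hx0 := H0 _ x0; have mHx : 0 <= m * H x by rewrite mulr_ge0.
have e1 : m * (phi y - phi x) * H x <= m * `|phi y - phi x| * H x.
  by rewrite ler_wpM2r// ler_wpM2l// ler_norm.
have e2 : m * (phi x - phi y) * H x <= m * `|phi y - phi x| * H x.
  by rewrite ler_wpM2r// ler_wpM2l// distrC ler_norm.
have e3 : m * phi x * (H y - H x) <= m * phi x * `|H y - H x|.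
  by rewrite ler_wpM2l// ler_norm.
have e4 : m * phi x * (H x - H y) <= m * phi x * `|H y - H x|.
  by rewrite ler_wpM2l// distrC ler_norm.
move: xy; rewrite neq_lt => /orP[xy|yx].
  have yx0 : 0 < y - x by rewrite subr_gt0.
  have /andP[] := cap_moment_slopes x0 xy y1.
  rewrite -(ler_pdivlMr _ _ yx0) -(ler_pdivrMr _ _ yx0).
  have -> : (H y - H x) / (y - x) = - ((H x - H y) / (y - x)) by ring.
  by move: (_ / (y - x)) => Q ? ?; lra.
have xy0 : 0 < x - y by rewrite subr_gt0.
have /andP[] := cap_moment_slopes y0 yx x1.
have -> : (H y - H x) / (y - x) = - ((H y - H x) / (x - y)).
  by rewrite -mulrN -invrN opprB.
rewrite -(ler_pdivlMr _ _ xy0) -(ler_pdivrMr _ _ xy0).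
by move: (_ / (x - y)) => Q ? ?; lra.
Qed.

Lemma is_derive_cap_moment (x : R) : 0 < x < 1 ->
  is_derive x 1 H (- (m * (x / (1 - x ^+ 2)) * H x)).
Proof.
move=> /[dup] x01 /andP[x0 x1]; rewrite -/(phi x).
apply/is_derive1_caratheodory.
exists (fun z => if z == x then - (m * phi x * H x) else (H z - H x) / (z - x)).
split; last by rewrite eqxx.
  move=> z; case: eqP => [->|/eqP zx]; first by rewrite !subrr mulr0.
  by rewrite divfK// subr_eq0.
have B0 : 0 < (1 + x) / 2 by lra.
have B1 : (1 + x) / 2 < 1 by lra.
have [C C0 CH] := cap_moment_continuous_upto nu_unif i B0 B1.
have phi_cont : {for x, continuous phi}.
  apply: cvgM; first exact: cvg_id.
  apply: cvgV; first by rewrite gt_eqF// one_subX_gt0.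
  by apply: cvgB; [exact: cvg_cst|exact: exprn_continuous].
rewrite /prop_for /continuous_at eqxx; apply/cvgrPdist_le => e e0.
have phix0 : 0 <= m * phi x by rewrite mulr_ge0// divr_ge0 ?ltW// one_subX_gt0.
pose K := m * phi x * C.
have K0 : 0 <= K by rewrite mulr_ge0.
near=> z.
have z0 : 0 < z by near: z; exact: lt_nbhsr.
have /ltW zB : z < (1 + x) / 2 by near: z; apply: lt_nbhsl; lra.
have z01 : 0 < z < 1 by rewrite z0 (le_lt_trans zB).
case: eqP => [_|/eqP zx]; first by rewrite subrr normr0 ltW.
rewrite distrC opprK (le_trans (cap_moment_quotient x01 z01 _))//; first by rewrite eq_sym.
have Hzx : `|H z - H x| <= C * `|x - z|.
  have [xz|/ltW zx'] := leP x z.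
    have Hzx : H z <= H x by apply: cap_moment_le => //; exact: ltW.
    rewrite distrC ger0_norm ?subr_ge0// (le_trans (CH _ _ x0 xz zB))//.
    by rewrite ler_wpM2l// distrC ler_norm.
  have Hxz : H x <= H z by apply: cap_moment_le => //; exact: ltW.
  have xB : x <= (1 + x) / 2 by lra.
  rewrite ger0_norm ?subr_ge0// (le_trans (CH _ _ z0 zx' xB))//.
  by rewrite ler_wpM2l// ler_norm.
have zx1 : (K + 1) * `|x - z| <= e / 2.
  rewrite mulrC -ler_pdivlMr ?ltr_wpDl//; near: z; apply: cvgr_dist_le; first exact: cvg_id.
  by rewrite !divr_gt0// ltr_wpDl.
have pzx : (m + 1) * `|phi x - phi z| <= e / 2.
  rewrite mulrC -ler_pdivlMr ?ltr_wpDl//; near: z; apply: cvgr_dist_le => //.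
  by rewrite !divr_gt0// ltr_wpDl.
rewrite (distrC (phi z)).
have := ler_wpM2l phix0 Hzx; have := normr_ge0 (x - z); have := normr_ge0 (phi x - phi z).
move: zx1; rewrite /K; lra.
Unshelve. all: by end_near. Qed.

(** A power of the square root, because (p - 1) / 2 need not be an integer. It solves the same
    linear equation as H. *)
Let cap_weight (x : R) := Num.sqrt (1 - x ^+ 2) ^+ p.-1.

Let is_derive_cap_weight (x : R) : 0 < x < 1 ->
  is_derive x 1 cap_weight (- (m * (x / (1 - x ^+ 2)) * cap_weight x)).
Proof.
move=> /andP[x0 x1]; have w0 := one_subX_gt0 x0 x1.
have d1 : is_derive x 1 (fun z : R => 1 - z ^+ 2) (- (2 * x)).
  have : is_derive x 1 (cst 1 - (@id R) ^+ 2) (0 - (2%:R * x ^+ 1) *: 1).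
    by apply: is_deriveB.
  by rewrite sub0r scaler1 expr1.
have d2 := @is_derive1_comp R Num.sqrt (fun z => 1 - z ^+ 2) x _ _ (is_derive1_sqrt w0) d1.
have := is_deriveX p.-1 d2.
have <- : cap_weight = (Num.sqrt \o (fun z => 1 - z ^+ 2)) ^+ p.-1.
  by apply/funext => z; rewrite exprfctE.
move=> h; apply: is_derive_eq h _.
rewrite /cap_weight -/m /=; set s := Num.sqrt _.
have s0 : s != 0 by rewrite gt_eqF// sqrtr_gt0.
have -> : 1 - x ^+ 2 = s ^+ 2 by rewrite sqr_sqrtr// ltW.
rewrite /GRing.scale/= /m; case: p.-1 => [|n] /=; first by rewrite !mulr0n !mul0r oppr0.
by rewrite [s ^+ n.+1]exprS; field.
Qed.

(** H / [cap_weight] has derivative zero on [a, b], hence equal values at the ends by the mean value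
    theorem. *)
Let cap_moment_ratio a b : 0 < a -> a < b -> b < 1 ->
  H a * cap_weight b = H b * cap_weight a.
Proof.
move=> a0 ab b1.
have c01 c : c \in `[a, b] -> 0 < c < 1 by rewrite in_itv/= => /andP[? ?]; lra.
have w0 c : 0 < c < 1 -> cap_weight c != 0.
  by move=> /andP[? ?]; rewrite gt_eqF// exprn_gt0// sqrtr_gt0 one_subX_gt0.
have d c : c \in `[a, b] -> is_derive c 1 (fun z => H z * (cap_weight z)^-1) 0.
  move=> /c01 cc; have cw0 := w0 _ cc.
  have := is_deriveM (is_derive_cap_moment cc) (is_deriveV cw0 (is_derive_cap_weight cc)).
  move=> h; apply: is_derive_eq h _; rewrite /GRing.scale/=.
  by move: (c / _) (H c) (cap_weight c) cw0 => q h' w cw0; rewrite /GRing.scale/=; field.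
pose h z := H z * (cap_weight z)^-1.
have hd (c : R) : c \in `]a, b[ -> is_derive c 1 h 0.
  by move=> cab; apply: d; exact: subset_itv_oo_cc cab.
have hc : {within `[a, b], continuous h}.
  by apply: derivable_within_continuous => c /d[].
have [c _] := @MVT R h (fun=> 0) a b ab hd hc.
rewrite mul0r => /eqP; rewrite subr_eq0 /h => /eqP hab.
have wa : cap_weight a != 0 by apply/w0/c01; rewrite in_itv/= lexx ltW.
have wb : cap_weight b != 0 by apply/w0/c01; rewrite in_itv/= lexx ltW.
by rewrite -[H b](divfK wb) hab; field.
Qed.

Lemma cap_momentE (s : R) : 0 <= s -> s < 1 ->
  H s = H 0 * Num.sqrt (1 - s ^+ 2) ^+ p.-1.
Proof.
rewrite le_eqVlt => /predU1P[<- _|s0 s1].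
  by rewrite expr0n/= subr0 sqrtr1 expr1n mulr1.
(* The equation is available on the open interval only, so the constant is identified by letting a
   tend to 0 from the right in [cap_moment_ratio]. *)
have cvgH : H a @[a --> 0^'+] --> H 0.
  apply/cvgrPdist_le => e e0; near=> a.
  have a0 : 0 <= a by near: a; exact: nbhs_right_ge.
  have ae : a <= e by near: a; exact: nbhs_right_le.
  have := cap_moment_ge_sub nu_unif i a0.
  have : H a <= H 0 by apply: cap_moment_le.
  by move=> ? ?; rewrite ger0_norm ?subr_ge0//; lra.
have cvgw : cap_weight a @[a --> 0^'+] --> (1 : R).
  have -> : 1 = cap_weight 0 by rewrite /cap_weight expr0n/= subr0 sqrtr1 expr1n.
  apply: cvg_at_right_filter.
  apply: (@continuous_comp _ _ _ (fun z : R => Num.sqrt (1 - z ^+ 2)) (fun z => z ^+ p.-1)).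
    apply: (@continuous_comp _ _ _ (fun z : R => 1 - z ^+ 2) (@Num.sqrt R)).
      by apply: cvgB; [exact: cvg_cst|exact: exprn_continuous].
    exact: sqrt_continuous.
  exact: exprn_continuous.
have cvgL : H a * cap_weight s @[a --> 0^'+] --> H 0 * cap_weight s by apply: cvgMl.
have cvgR : H s * cap_weight a @[a --> 0^'+] --> H s * 1 by apply: cvgMr.
rewrite mulr1 in cvgR; apply/esym; rewrite -/(cap_weight s).
rewrite -(cvg_lim (@Rhausdorff R) cvgL); apply: cvg_lim => //.
apply: cvg_trans cvgR; apply: near_eq_cvg; near=> a.
have a0 : 0 < a by near: a; exact: nbhs_right_gt.
have a_s : a < s by near: a; exact: nbhs_right_lt.
by rewrite (cap_moment_ratio a0 a_s s1).
Unshelve. all: by end_near. Qed.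

End cap_moment_closed_form.

(** * Wallis integrals and the moment at zero *)

Section wallis.
Context (R : realType).
Local Notation mu := (@lebesgue_measure R).

Lemma Rintegral_FTC (f F : R -> R) (a b : R) : a < b -> continuous f ->
  continuous F -> (forall x, a < x < b -> is_derive x 1 F (f x)) ->
  \int[mu]_(x in `[a, b]) f x = F b - F a.
Proof.
move=> ab cf cF dF; rewrite /Rintegral (@continuous_FTC2 _ f F)//.
- exact: continuous_subspaceT.
- split => [x||]; first by rewrite in_itv/= => /dF[].
  + exact/cvg_at_right_filter/cF.
  + exact/cvg_at_left_filter/cF.
- by move=> x; rewrite in_itv/= => /dF h; rewrite derive1E derive_val.
Qed.

Definition wallis (n : nat) : R := \int[mu]_(x in `[0, pi / 2]) (cos x ^+ n).

Let pihalf_gt0 : 0 < pi / 2 :> R. Proof. by rewrite divr_gt0// pi_gt0. Qed.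

Let continuous_cosX n : continuous (fun x : R => cos x ^+ n).
Proof.
move=> x; apply: (@continuous_comp _ _ _ (@cos R) (fun z : R => z ^+ n)).
  exact: continuous_cos.
exact: exprn_continuous.
Qed.

Let integrable_cosX n : mu.-integrable `[0, pi / 2] (EFin \o (fun x : R => cos x ^+ n)).
Proof.
apply: continuous_compact_integrable; first exact: segment_compact.
exact/continuous_subspaceT/continuous_cosX.
Qed.

Lemma wallis0 : wallis 0 = pi / 2.
Proof.
rewrite /wallis (@Rintegral_FTC _ id) /= ?subr0//.
by move=> x; exact: cvg_id.
Qed.

Lemma wallis1 : wallis 1 = 1.
Proof.
rewrite /wallis (@Rintegral_FTC _ (@sin R))// ?sin0 ?subr0 ?sin_pihalf//.
exact: continuous_sin.
Qed.

(** The difference of the two integrands is the derivative of cos^(n + 1) sin, which vanishes at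
    both ends. *)
Lemma wallis_rec n : n.+2%:R * wallis n.+2 = n.+1%:R * wallis n.
Proof.
apply/eqP; rewrite -subr_eq0; apply/eqP.
rewrite -!RintegralZl// -RintegralB//; last 2 first.
- apply: continuous_compact_integrable; first exact: segment_compact.
  by apply/continuous_subspaceT => x; apply: cvgMr; exact: continuous_cosX.
- apply: continuous_compact_integrable; first exact: segment_compact.
  by apply/continuous_subspaceT => x; apply: cvgMr; exact: continuous_cosX.
transitivity (cos (pi / 2) ^+ n.+1 * sin (pi / 2) - cos 0 ^+ n.+1 * sin 0 : R); last first.
  by rewrite cos_pihalf sin0 expr0n !(mul0r, mulr0) subr0.
apply: (@Rintegral_FTC (fun x => n.+2%:R * cos x ^+ n.+2 - n.+1%:R * cos x ^+ n)
  (fun x => cos x ^+ n.+1 * sin x)) => //.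
- by move=> x; apply: cvgB; apply: cvgMr; exact: continuous_cosX.
- by move=> x; apply: cvgM; [exact: continuous_cosX|exact: continuous_sin].
move=> x _.
have -> : (fun x => cos x ^+ n.+1 * sin x) = (@cos R) ^+ n.+1 * (@sin R).
  by apply/funext => z; rewrite mulrfctE exprfctE.
have := is_deriveM (is_deriveX n.+1 (is_derive_cos x)) (is_derive_sin x).
move=> h; apply: is_derive_eq h _; rewrite exprfctE /GRing.scale/=.
have -> : sin x * (n.+1%:R * cos x ^+ n * - sin x) =
  - (n.+1%:R * cos x ^+ n) * sin x ^+ 2 by ring.
by rewrite sin2cos2 -[n.+2%:R]natr1 !exprS; ring.
Qed.

(** The recursion leaves this product invariant. Together with monotonicity it determines the square
    of the n-th integral up to a factor 1 + 1 / n. *)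
Lemma wallis_mul n : n.+1%:R * wallis n.+1 * wallis n = pi / 2.
Proof.
elim: n => [|n IH]; first by rewrite wallis0 wallis1 mul1r mul1r.
by rewrite wallis_rec -IH mulrAC.
Qed.

Lemma wallis_ge0 n : 0 <= wallis n.
Proof.
apply: Rintegral_ge0 => x /=; rewrite in_itv/= => /andP[x0 x1].
by rewrite exprn_ge0// cos_ge0_pihalf// x1 andbT; lra.
Qed.

Lemma wallis_decr n : wallis n.+1 <= wallis n.
Proof.
apply: le_Rintegral => // x; rewrite /= in_itv/= => /andP[x0 x1].
rewrite exprS ler_piMl// ?cos_le1// exprn_ge0// cos_ge0_pihalf// x1 andbT; lra.
Qed.

Lemma wallis_sqr_bounds n :
  pi / 2 / n.+2%:R <= wallis n.+1 ^+ 2 <= pi / 2 / n.+1%:R.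
Proof.
rewrite expr2; apply/andP; split.
  rewrite ler_pdivrMr// -(wallis_mul n.+1).
  have := ler_wpM2l (ler0n R n.+2) (ler_wpM2r (wallis_ge0 n.+1) (wallis_decr n.+1)).
  lra.
rewrite ler_pdivlMr// -(wallis_mul n).
have := ler_wpM2l (ler0n R n.+1) (ler_wpM2l (wallis_ge0 n.+1) (wallis_decr n)).
lra.
Qed.

End wallis.

Section cap_moment0.
Context (R : realType) (p : nat).
Variables (nu : probability (p.-tuple R) R) (nu_unif : uniform_on_sphere nu).
Variable i : 'I_p.
Local Notation S := (@unit_sphere R p).
Local Notation bounded := (bounded_measurable S).
Local Notation H := (cap_moment nu i).

Let mS : measurable S := @measurable_unit_sphere R p.
Let integrable_bounded := @bounded_measurable_integrable _ _ _ nu _ mS.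
Let bi : bounded (fun y => tnth y i) := @bounded_tnth R p i.

(** Stein's inequality for f = id and f = - id gives (p - 1) E[y_i^2] = 1 - E[y_i^2]. *)
Lemma second_moment : p%:R * \int[nu]_(y in S) (tnth y i * tnth y i) = 1.
Proof.
have p0 : (0 < p)%N by case: (p) i => [[]|].
have mid : measurable_fun setT (@id R) by exact: measurable_id.
have E1 : \int[nu]_(y in S) (1 - tnth y i ^+ 2) =
    1 - \int[nu]_(y in S) (tnth y i * tnth y i).
  under eq_Rintegral do rewrite expr2.
  rewrite RintegralB ?(Rintegral_sphere_cst nu_unif)//.
    by apply: integrable_bounded; bounded_measurability.
  by apply: integrable_bounded; bounded_measurability.
have up := @stein_inequality _ _ _ nu_unif i id (fun=> 1) 1 1 1.
have low := @stein_inequality _ _ _ nu_unif i (fun x => - x) (fun=> -1) 1 1 1.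
have EN (f : p.-tuple R -> R) : bounded f ->
    \int[nu]_(y in S) (- f y) = - \int[nu]_(y in S) f y.
  move=> bf; rewrite -mulN1r -RintegralZl//; last exact: integrable_bounded.
  by apply: eq_Rintegral => y _; rewrite mulN1r.
have le1 : p.-1%:R * \int[nu]_(y in S) (tnth y i * tnth y i) <=
    1 - \int[nu]_(y in S) (tnth y i * tnth y i).
  rewrite -E1 [leRHS](@eq_Rintegral _ _ _ nu S (fun y => 1 * (1 - tnth y i ^+ 2))); last first.
    by move=> y _; rewrite mul1r.
  apply: up => //; [by move=> x y; rewrite mul1r|by move=> _; rewrite normr1|].
  by move=> u x y _ _ _ xy; rewrite mul1r.
have ge1 : 1 - \int[nu]_(y in S) (tnth y i * tnth y i) <=
    p.-1%:R * \int[nu]_(y in S) (tnth y i * tnth y i).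
  rewrite -E1 -lerN2 -mulrN -!EN; [|by bounded_measurability..].
  rewrite (@eq_Rintegral _ _ _ nu S (fun y => - tnth y i * tnth y i)); last first.
    by move=> y _; rewrite mulNr.
  rewrite [leRHS](@eq_Rintegral _ _ _ nu S (fun y => -1 * (1 - tnth y i ^+ 2))); last first.
    by move=> y _; rewrite mulN1r.
  apply: low => //.
  - exact: oppr_measurable.
  - by move=> x y; rewrite -opprD normrN mul1r.
  - by move=> _; rewrite normrN1.
  - by move=> u x y _ _ _ xy; rewrite mulN1r opprB opprK addrC.
have -> : p%:R = p.-1%:R + 1 :> R by rewrite natr1 prednK.
clear up low; lra.
Qed.

(** An explicit antiderivative of - H, used instead of an exchange of integrals: U 0 - U 1 is the
    integral of H over [0, 1]. *)
Let U (s : R) := \int[nu]_(y in S) (Num.max 0 (tnth y i - s) * tnth y i).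

Let bounded_max s : bounded (fun y => Num.max 0 (tnth y i - s)).
Proof.
apply: (@bounded_lipschitz_comp _ _ (fun x => Num.max 0 x) 1).
- by apply: measurable_maxr => //; exact: measurable_id.
- move=> x y; rewrite mul1r ler_norml.
  have := ler_norm (x - y); have := ler_norm (y - x); rewrite distrC.
  by case: (leP 0 x) => ?; case: (leP 0 y) => ?; move: `|_| => a; lra.
- by bounded_measurability.
Qed.

Let UB a b : U a - U b = \int[nu]_(y in S)
  ((Num.max 0 (tnth y i - a) - Num.max 0 (tnth y i - b)) * tnth y i).
Proof.
have [ba bb] := (bounded_max a, bounded_max b).
rewrite -RintegralB//; [|by apply: integrable_bounded; bounded_measurability..].
by apply: eq_Rintegral => y _; rewrite mulrBl.
Qed.

Let U_le a b : a <= b -> U a - U b <= b - a.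
Proof.
move=> ab; have [ba bb] := (bounded_max a, bounded_max b).
rewrite UB -[leRHS](Rintegral_sphere_cst nu_unif).
apply: ler_bounded_Rintegral => //; [by bounded_measurability..|].
move=> y /(tnth_normr_le1 i); rewrite ler_norml; move: (tnth y i) => u.
case: (leP 0 (u - a)) => ?; case: (leP 0 (u - b)) => ?; nra.
Qed.

Let U_ge a b : a <= b -> a - b <= U a - U b.
Proof.
move=> ab; have [ba bb] := (bounded_max a, bounded_max b).
rewrite UB -[leLHS](Rintegral_sphere_cst nu_unif).
apply: ler_bounded_Rintegral => //; [by bounded_measurability..|].
move=> y /(tnth_normr_le1 i); rewrite ler_norml; move: (tnth y i) => u.
case: (leP 0 (u - a)) => ?; case: (leP 0 (u - b)) => ?; nra.
Qed.

Let U_slope a b : 0 <= a -> a <= b ->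
  (b - a) * H b <= U a - U b <= (b - a) * H a.
Proof.
move=> a0 ab; have [ba bb] := (bounded_max a, bounded_max b).
have [Ha Hb] := (bounded_lt_tnth i a, bounded_lt_tnth i b).
rewrite UB -!RintegralZl//; [|by apply: integrable_bounded; bounded_measurability..].
apply/andP; split; apply: ler_bounded_Rintegral => //;
  try (by bounded_measurability); move=> y _; move: (tnth y i) => u;
  case: (leP 0 (u - a)) => ?; case: (leP 0 (u - b)) => ?;
  case: ltP => ? /=; nra.
Qed.

Let continuous_U : continuous U.
Proof.
move=> x; apply/cvgrPdist_le => e e0; near=> z.
have : `|x - z| <= e by near: z; apply: cvgr_dist_le => //; exact: cvg_id.
rewrite !ler_norml; have [xz|/ltW zx] := leP x z.
  by have := U_le xz; have := U_ge xz; lra.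
by have := U_le zx; have := U_ge zx; lra.
Unshelve. all: by end_near. Qed.

Let is_derive_U (x : R) : 0 < x < 1 -> is_derive x 1 U (- H x).
Proof.
move=> /andP[x0 x1]; apply/is_derive1_caratheodory.
exists (fun z => if z == x then - H x else (U z - U x) / (z - x)).
split; last by rewrite eqxx.
  move=> z; case: eqP => [->|/eqP zx]; first by rewrite !subrr mulr0.
  by rewrite divfK// subr_eq0.
have B0 : 0 < (1 + x) / 2 by lra.
have B1 : (1 + x) / 2 < 1 by lra.
have [C C0 CH] := cap_moment_continuous_upto nu_unif i B0 B1.
rewrite /prop_for /continuous_at eqxx; apply/cvgrPdist_le => e e0.
near=> z.
have z0 : 0 < z by near: z; exact: lt_nbhsr.
have /ltW zB : z < (1 + x) / 2 by near: z; apply: lt_nbhsl; lra.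
have /ltW xB : x < (1 + x) / 2 by lra.
have zx1 : (C + 1) * `|x - z| <= e.
  rewrite mulrC -ler_pdivlMr ?ltr_wpDl//; near: z; apply: cvgr_dist_le; first exact: cvg_id.
  by rewrite !divr_gt0// ltr_wpDl.
case: eqP => [_|/eqP]; first by rewrite subrr normr0 ltW.
rewrite neq_lt => /orP[zx|xz].
  have xz0 : 0 < x - z by rewrite subr_gt0.
  have HzHx := CH _ _ z0 (ltW zx) xB; have /andP[] := U_slope (ltW z0) (ltW zx).
  rewrite gtr0_norm// in zx1.
  have -> : (U z - U x) / (z - x) = - ((U z - U x) / (x - z)).
    by rewrite -mulrN -invrN opprB.
  rewrite [leLHS]mulrC -(ler_pdivlMr _ _ xz0) => Q1.
  rewrite [leRHS]mulrC -(ler_pdivrMr _ _ xz0) => Q2.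
  by move: (_ / _) Q1 Q2 => Q Q1 Q2; rewrite ler_norml; lra.
have xz0 : 0 < z - x by rewrite subr_gt0.
have HxHz := CH _ _ x0 (ltW xz) zB; have /andP[] := U_slope (ltW x0) (ltW xz).
rewrite distrC gtr0_norm// in zx1.
have -> : (U z - U x) / (z - x) = - ((U x - U z) / (z - x)) by rewrite -mulNr opprB.
rewrite [leLHS]mulrC -(ler_pdivlMr _ _ xz0) => Q1.
rewrite [leRHS]mulrC -(ler_pdivrMr _ _ xz0) => Q2.
by move: (_ / _) Q1 Q2 => Q Q1 Q2; rewrite ler_norml; lra.
Unshelve. all: by end_near. Qed.

Let U1 : U 1 = 0.
Proof.
rewrite /U (@eq_Rintegral _ _ _ _ _ (fun=> 0)).
  by rewrite Rintegral_cst// mul0r.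
move=> y; rewrite inE => Sy; have := tnth_normr_le1 i Sy.
rewrite ler_norml => /andP[_ y1]; rewrite max_l ?mul0r//; lra.
Qed.

(** The reflection along e_i exchanges the two half-spheres, so U 0 is half of E[y_i^2]. *)
Let U0 : U 0 = 1 / (2 * p%:R).
Proof.
have p0 : p%:R != 0 :> R by case: (p) i => [[]//|n _]; rewrite pnatr_eq0.
pose e : p.-tuple R := [tuple (k == i)%:R | k < p].
have de y : dotp e y = tnth y i.
  rewrite /dotp (bigD1 i)//= tnth_mktuple eqxx mul1r big1 ?addr0// => k /negbTE kj.
  by rewrite tnth_mktuple kj mul0r.
have b0 := bounded_max 0.
have bU : bounded (fun y => Num.max 0 (tnth y i - 0) * tnth y i).
  by bounded_measurability.
have sym := reflection_invariance nu_unif e bU.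
have := second_moment.
have -> : \int[nu]_(y in S) (tnth y i * tnth y i) = U 0 + U 0.
  rewrite -{1}[U 0]sym /U -RintegralD//; last 2 first.
  - apply: integrable_bounded; case: bU => mU [M UM]; split.
      exact: measurableT_comp mU (measurable_reflection e).
    exists M => y Sy; apply: UM.
    by have : (reflection e @^-1` S) y by rewrite reflection_sphere.
  - exact: integrable_bounded.
  apply: eq_Rintegral => y _ /=.
  rewrite !tnth_reflection !de !tnth_mktuple eqxx divr1 mulr1n mulr1 !subr0.
  move: (tnth y i) => u; have -> : u - 2 * u = - u by ring.
  by case: (leP 0 (- u)) => ?; case: (leP 0 u) => ?; nra.
by move=> h; apply: (mulfI p0); field: h.
Qed.

(** The substitution s = sin x in the integral of H over [0, 1] turns (1 - s^2)^((p - 1) / 2) ds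
    into cos^p x dx. *)
Lemma cap_moment0_wallis : H 0 * wallis R p = 1 / (2 * p%:R).
Proof.
have p0 : (0 < p)%N by case: (p) i => [[]|].
have pi0 : 0 < pi / 2 :> R by rewrite divr_gt0// pi_gt0.
have V (x : R) : 0 < x < pi / 2 -> is_derive x 1 (fun x => - U (sin x)) (H 0 * cos x ^+ p).
  move=> /andP[x0 x1]; have c0 : 0 < cos x by rewrite cos_gt0_pihalf// x1 andbT; lra.
  have s0 : 0 < sin x by rewrite sin_gt0_pi// x0/=; lra.
  have s1 : sin x < 1.
    have : sin x ^+ 2 < 1 by rewrite sin2cos2 ltrBlDr ltrDl exprn_gt0.
    by rewrite -[ltRHS](expr1n _ 2) ltr_pXn2r// nnegrE ltW.
  have s01 : 0 < sin x < 1 by rewrite s0.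
  have := @is_deriveN _ _ _ (U \o sin) x 1 _
    (@is_derive1_comp R U (@sin R) x _ _ (is_derive_U s01) (is_derive_sin x)).
  move=> h; apply: is_derive_eq h _.
  rewrite cap_momentE ?ltW// -cos2sin2 sqrtr_sqr gtr0_norm// mulNr opprK.
  by rewrite -mulrA -exprSr prednK.
have <- : U 0 = 1 / (2 * p%:R) by exact: U0.
rewrite /wallis -RintegralZl//; last first.
  apply: continuous_compact_integrable; first exact: segment_compact.
  apply/continuous_subspaceT => x; apply: (@continuous_comp _ _ _ (@cos R) (fun z : R => z ^+ p)).
    exact: continuous_cos.
  exact: exprn_continuous.
rewrite (@Rintegral_FTC _ (fun x => H 0 * cos x ^+ p) (fun x => - U (sin x)))//.
- by rewrite sin_pihalf sin0 U1 oppr0 sub0r opprK.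
- move=> x; apply: cvgMr; apply: (@continuous_comp _ _ _ (@cos R) (fun z : R => z ^+ p)).
    exact: continuous_cos.
  exact: exprn_continuous.
- move=> x; apply: cvgN; apply: (@continuous_comp _ _ _ (@sin R) U).
    exact: continuous_sin.
  exact: continuous_U.
Qed.

Lemma cap_moment0_sqr_bounds :
  1 <= 2 * pi * p%:R * H 0 ^+ 2 <= 1 + p%:R^-1.
Proof.
have p0 : (0 < p)%N by case: (p) i => [[]|].
have P0 : 0 < p%:R :> R by rewrite ltr0n.
have pi0 := pi_gt0 R.
have := wallis_sqr_bounds R p.-1; rewrite prednK// => /andP[].
rewrite -[p.+1%:R]natr1 ler_pdivrMr ?addr_gt0// ler_pdivlMr//.
have h : (2 * p%:R * H 0 * wallis R p) = 1.
  by rewrite -mulrA cap_moment0_wallis; field; rewrite gt_eqF.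
have {h}h : 4 * p%:R ^+ 2 * H 0 ^+ 2 * wallis R p ^+ 2 = 1.
  transitivity ((2 * p%:R * H 0 * wallis R p) ^+ 2); first by ring.
  by rewrite h expr1n.
have w0 : 0 < wallis R p ^+ 2.
  rewrite lt_def sqr_ge0 andbT; apply/eqP => w0; move: h; rewrite w0 mulr0 => /eqP.
  by rewrite eq_sym oner_eq0.
move=> h1 h2; apply/andP; split.
  rewrite -(ler_pM2r w0) -(ler_pM2l P0) mul1r.
  have -> : p%:R * (2 * pi * p%:R * H 0 ^+ 2 * wallis R p ^+ 2) =
    pi / 2 * (4 * p%:R ^+ 2 * H 0 ^+ 2 * wallis R p ^+ 2) by field.
  by rewrite h mulr1 mulrC.
rewrite -(ler_pM2r w0) -(ler_pM2l P0).
have -> : p%:R * (2 * pi * p%:R * H 0 ^+ 2 * wallis R p ^+ 2) =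
  pi / 2 * (4 * p%:R ^+ 2 * H 0 ^+ 2 * wallis R p ^+ 2) by field.
rewrite h mulr1; have -> : p%:R * ((1 + p%:R^-1) * wallis R p ^+ 2) =
  wallis R p ^+ 2 * (p%:R + 1) by field; rewrite gt_eqF.
done.
Qed.

End cap_moment0.

(** * From the truncated moment to the tail probability *)

Lemma probability1_setI d (T : measurableType d) (R : realType)
    (P : probability T R) (S A : set T) : measurable S -> measurable A ->
  P S = 1%E -> P (S `&` A) = P A.
Proof.
move=> mS mA PS; rewrite [RHS](measureDI P mA mS) setIC.
rewrite [X in _ = (X + _)%E](_ : _ = 0%E) ?add0e//; apply/eqP; rewrite eq_le measure_ge0 andbT.
have <- : P (~` S) = 0%E by rewrite probability_setC// PS subee.
apply: le_measure; rewrite ?inE; try exact: measurableC.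
  exact: measurableD.
by move=> x [].
Qed.

Section mills.
Context (R : realType) (p : nat).
Variables (nu : probability (p.-tuple R) R) (nu_unif : uniform_on_sphere nu).
Variable i : 'I_p.
Local Notation S := (@unit_sphere R p).
Local Notation bounded := (bounded_measurable S).
Local Notation H := (cap_moment nu i).

Let mS : measurable S := @measurable_unit_sphere R p.
Let integrable_bounded := @bounded_measurable_integrable _ _ _ nu _ mS.
Let bi : bounded (fun y => tnth y i) := @bounded_tnth R p i.

Lemma measurable_tnth_preimage A : measurable A ->
  measurable [set y : p.-tuple R | A (tnth y i)].
Proof.
move=> mA; rewrite -[X in measurable X]setTI.
exact: (measurable_tnthr i).
Qed.

Let Rintegral_sphere_bool (b : R -> bool) : measurable [set x | b x] ->
  \int[nu]_(y in S) (b (tnth y i))%:R = fine (nu [set y | b (tnth y i)]).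
Proof.
move=> mb; have mb' := measurable_tnth_preimage mb.
rewrite /Rintegral (_ : (fun y => ((b (tnth y i))%:R)%:E) =
  (fun y => (\1_[set y | b (tnth y i)] y)%:E)); last first.
  apply/funext => y; rewrite indicE.
  by case: (boolP (b _)) => h; [rewrite mem_set|rewrite memNset//=; exact/negP].
rewrite integral_indic//; congr fine; rewrite setIC.
exact: (probability1_setI mS mb' nu_unif.1).
Qed.

Let bounded_bool (b : R -> bool) : measurable [set x | b x] ->
  bounded (fun y => (b (tnth y i))%:R : R).
Proof.
move=> mb; apply: bounded_measurable_bool.
apply: (measurableT_comp (f := b)); last exact: measurable_tnthr.
apply: (measurable_fun_bool true); rewrite setTI.
by rewrite (_ : _ @^-1` _ = [set x | b x])//; apply/seteqP; split=> x /=.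
Qed.

(** Only values in (s, s'] are counted, where y_i is at most s'. Later s' is a second threshold,
    close to s in ratio but with a much smaller moment. *)
Lemma cap_moment_mills_lower (s s' : R) : 0 <= s -> s < s' ->
  H s - H s' <= s' * fine (nu [set y | s < tnth y i]).
Proof.
move=> s0 ss'.
have ms : measurable [set x | s < x].
  by rewrite -set_itvoy; exact: measurable_itv.
have [bs bs'] := (bounded_lt_tnth i s, bounded_lt_tnth i s').
rewrite -(Rintegral_sphere_bool ms) cap_momentB -RintegralZl//; last exact: integrable_bounded.
apply: ler_bounded_Rintegral => //; [by bounded_measurability..|] => y _.
by case: ltP => ?; case: ltP => ? /=; nra.
Qed.

(** The cap is closed whereas H counts y_i > s, hence the detour through s - d and the continuity of
    H. Closed caps come from the condition that the cosine of the maximal angle is at most - s. *)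
Lemma cap_moment_mills_upper (s : R) : 0 < s -> s < 1 ->
  s * fine (nu [set y | s <= tnth y i]) <= H s.
Proof.
move=> s0 s1.
have ms : measurable [set x | s <= x].
  by rewrite -set_itvcy; exact: measurable_itv.
have bs := bounded_bool ms.
have [C C0 CH] := cap_moment_continuous_upto nu_unif i s0 s1.
apply/ler_addgt0Pr => e e0.
pose d := Num.min (s / 2) (e / (C + 1)).
have d0 : 0 < d by rewrite /d lt_min !divr_gt0// ltr_wpDl.
have ds : d <= s / 2 by rewrite /d ge_min lexx.
have de : (C + 1) * d <= e.
  by rewrite mulrC -ler_pdivlMr ?ltr_wpDl// /d ge_min lexx orbT.
clearbody d.
have sd0 : 0 < s - d by lra.
have sds : s - d <= s by lra.
have := CH _ _ sd0 sds (lexx s).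
have bsd := bounded_lt_tnth i (s - d).
have : s * fine (nu [set y | s <= tnth y i]) <= H (s - d).
  rewrite -(Rintegral_sphere_bool ms) -RintegralZl//; last exact: integrable_bounded.
  apply: ler_bounded_Rintegral => //; [by bounded_measurability..|] => y _.
  move: (tnth y i) => u; have [su|us] := leP s u;
    by have [du|ud] := ltP (s - d) u => /=;
      rewrite ?mulr1n ?mulr0n ?mulr1 ?mulr0 ?mul1r ?mul0r; lra.
have -> : s - (s - d) = d by ring.
lra.
Qed.

End mills.

(** * Asymptotics of the tail *)

Section threshold.
Context (R : realType).

Lemma expR_le_oneB (y : R) : y <= 1 / 2 -> expR (- y - 2 * y ^+ 2) <= 1 - y.
Proof.
move=> y2; have v0 : 0 < 1 + (y + 2 * y ^+ 2) by nra.
have -> : - y - 2 * y ^+ 2 = - (y + 2 * y ^+ 2) by ring.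
rewrite expRN; apply: (@le_trans _ _ (1 + (y + 2 * y ^+ 2))^-1).
  by rewrite lef_pV2 ?posrE ?expR_gt0// expR_ge1Dx.
rewrite -[leLHS]mul1r ler_pdivrMr//.
have : 0 <= y ^+ 2 * (1 - 2 * y) by rewrite mulr_ge0 ?sqr_ge0//; lra.
lra.
Qed.

Section weight_bounds.
Variables (N : nat) (t w r : R).
Let K := N%:R * (1 - t ^+ 2).
Let sigma := Num.sqrt (1 - t ^+ 2).
Let s := sigma + t ^+ 2 / (2 * N%:R * sigma) * w.
Hypotheses (t0 : 0 < t) (t1 : t < 1) (N0 : (0 < N)%N).
Hypotheses (rK : (1 + `|w|) ^+ 2 <= r * K) (r4 : r <= 1 / 4).

Let t2_gt0 : 0 < t ^+ 2. Proof. by rewrite exprn_gt0. Qed.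
Let t2_lt1 : t ^+ 2 < 1. Proof. by rewrite exprn_ilt1// ltW. Qed.
Let N_gt0 : 0 < N%:R :> R. Proof. by rewrite ltr0n. Qed.
Let K_gt0 : 0 < K. Proof. by rewrite mulr_gt0// subr_gt0. Qed.
Let K_leN : K <= N%:R. Proof. by rewrite /K ler_piMr ?(ltW N_gt0)// lerBlDr lerDl ltW. Qed.
Let sigma_gt0 : 0 < sigma. Proof. by rewrite sqrtr_gt0 subr_gt0. Qed.
Let sigma2 : sigma ^+ 2 = 1 - t ^+ 2.
Proof. by rewrite sqr_sqrtr// subr_ge0 ltW. Qed.
Let KE : K = N%:R * sigma ^+ 2. Proof. by rewrite sigma2. Qed.
Let w0 : 0 <= `|w|. Proof. exact: normr_ge0. Qed.
Let r0 : 0 <= r.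
Proof. by rewrite -(pmulr_lge0 _ K_gt0) (le_trans _ rK)// sqr_ge0. Qed.

(** As K = N sigma^2, s = (1 + t^2 w / (2 K)) sigma. The number r, a bound for (1 + |w|)^2 / K,
    controls every error of this section. *)
Lemma threshold_ratio_bounds : (1 - r / 2) * sigma <= s <= (1 + r / 2) * sigma.
Proof.
have -> : s = (1 + t ^+ 2 * (w / K) / 2) * sigma.
  by rewrite /s KE; field; rewrite !gt_eqF.
have wK : `|w / K| <= r.
  rewrite normrM (gtr0_norm (_ : 0 < K^-1)) ?invr_gt0// ler_pdivrMr//.
  by rewrite (le_trans _ rK)//; have := w0; nra.
have : `|t ^+ 2 * (w / K)| <= r.
  by rewrite normrM -[leRHS]mul1r ler_pM// gtr0_norm// ltW.
rewrite ler_norml => /andP[h1 h2].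
by rewrite !ler_pM2r//; apply/andP; split; lra.
Qed.

(** Chosen so that 1 - s^2 = t^2 (1 - (w + delta) / N) exactly: delta comes from the square of the
    correction term of s. *)
Let delta := t ^+ 2 * w ^+ 2 / (4 * K).
Let x := w + delta.
Let y := x / N%:R.

Let delta_bounds : 0 <= delta <= r / 4.
Proof.
have K4 : 0 < 4 * K by rewrite mulr_gt0.
have tw0 : 0 <= t ^+ 2 * w ^+ 2 by apply: mulr_ge0; exact: sqr_ge0.
rewrite /delta divr_ge0 ?(ltW K4)//=.
rewrite ler_pdivrMr//.
have -> : r / 4 * (4 * K) = r * K by field.
apply: le_trans rK; rewrite -[w ^+ 2]real_normK ?num_real//.
have : t ^+ 2 * `|w| ^+ 2 <= 1 * `|w| ^+ 2 by rewrite ler_wpM2r ?sqr_ge0// ltW.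
by have := w0; lra.
Qed.

Let x_norm : `|x| <= 1 + `|w|.
Proof.
have /andP[d0 d1] := delta_bounds.
rewrite /x (le_trans (ler_normD _ _))// [leLHS]addrC lerD2r (ger0_norm d0) (le_trans d1)//.
by have := r4; lra.
Qed.

Let x_sqr : x ^+ 2 <= r * K.
Proof.
rewrite (le_trans _ rK)// -[x ^+ 2]real_normK ?num_real//.
by rewrite ler_pXn2r// nnegrE addr_ge0.
Qed.

Let y_norm : `|y| <= r.
Proof.
rewrite /y normrM (gtr0_norm (_ : 0 < N%:R^-1)) ?invr_gt0// ler_pdivrMr//.
apply: (@le_trans _ _ (r * K)); last by rewrite ler_wpM2l.
by apply: (le_trans x_norm); apply: le_trans rK; have := w0; nra.
Qed.

Let one_subs2 : 1 - s ^+ 2 = t ^+ 2 * (1 - y).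
Proof.
have -> : s ^+ 2 = sigma ^+ 2 + t ^+ 2 * w / N%:R +
    t ^+ 2 * t ^+ 2 * w ^+ 2 / (4 * N%:R * (N%:R * sigma ^+ 2)).
  by rewrite /s; field; rewrite !gt_eqF.
by rewrite -KE sigma2 /y /x /delta; field; rewrite !gt_eqF.
Qed.

Lemma threshold_range : 0 < s < 1.
Proof.
have /andP[h _] := threshold_ratio_bounds.
have s0 : 0 < s by rewrite (lt_le_trans _ h)// mulr_gt0//; have := r4; lra.
rewrite s0/= -[ltRHS](sqrtr1) -[s]gtr0_norm// -sqrtr_sqr ltr_sqrt//.
rewrite -subr_gt0 one_subs2 mulr_gt0//.
by move: y_norm; rewrite ler_norml; have := r4; lra.
Qed.

(** The powers of t cancel, leaving (1 - y)^N e^w with N y = w + delta. The loss 3 r collects delta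
    <= r / 4 and 2 N y^2 <= 2 r. *)
Lemma weight_bounds : expR (- (3 * r)) <=
  (1 - s ^+ 2) ^+ N * expR w / (t ^+ 2) ^+ N <= 1.
Proof.
have tN : (t ^+ 2) ^+ N != 0 by rewrite expf_neq0// gt_eqF.
rewrite one_subs2 exprMn.
have -> : (t ^+ 2) ^+ N * (1 - y) ^+ N * expR w / (t ^+ 2) ^+ N = (1 - y) ^+ N * expR w.
  by rewrite -[X in X / _]mulrA mulrAC mulfV// mul1r.
have /andP[d0 d1] := delta_bounds.
have Ny : N%:R * y = x by rewrite /y mulrC divfK// gt_eqF.
have y1 : y <= 1 / 2 by move: y_norm; rewrite ler_norml; have := r4; lra.
apply/andP; split.
  have := expR_le_oneB y1; rewrite -(ler_pXn2r N0) ?nnegrE ?expR_ge0//; last first.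
    by move: y1; lra.
  rewrite -expRM_natl mulrBr mulrN Ny => h.
  apply: (@le_trans _ _ (expR (- x - N%:R * (2 * y ^+ 2)) * expR w)).
    rewrite -expRD ler_expR /x.
    have : N%:R * (2 * y ^+ 2) <= 2 * r.
      have -> : N%:R * (2 * y ^+ 2) = 2 * (x ^+ 2 / N%:R).
        by rewrite /y; field; rewrite gt_eqF.
      rewrite ler_pM2l// ler_pdivrMr// (le_trans x_sqr)// ler_wpM2l//.
    lra.
  by rewrite ler_wpM2r// expR_ge0.
apply: (@le_trans _ _ (expR (- x) * expR w)).
  rewrite ler_wpM2r ?expR_ge0// -Ny -(mulrN N%:R y) expRM_natl.
  by rewrite ler_pXn2r ?nnegrE ?expR_ge0 ?expR_ge1Dx//; lra.
rewrite -expRD -[leRHS](@expR0 R) ler_expR /x; lra.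
Qed.

End weight_bounds.

End threshold.

Section threshold_limits.
Context (R : realType) (p : nat -> nat).
Hypothesis hp : forall n, (2 <= n)%N -> (2 <= p n)%N.
Hypothesis p_infty : p n @[n --> \oo] --> \oo.

Let t n : R := t_ R n (p n).
Let N n : R := (p n).-1%:R.
Let K n : R := N n * (1 - t n ^+ 2).
Let sigma n : R := Num.sqrt (1 - t n ^+ 2).

(** The value of cos Theta_min at which [C_min] equals z. By symmetry, minus the threshold at - z
    plays this role for [C_max]. *)
Definition threshold (n : nat) (z : R) : R :=
  sigma n + alpha_ R n (p n) * t n * (z - ln (K n)).

Let NE n : (2 <= n)%N -> (p n)%:R - 1 = N n.
Proof.
move=> n2; rewrite /N -[in LHS](ltn_predK (hp n2)) -natr1; lra.
Qed.

Let N_gt0 n : (2 <= n)%N -> 0 < N n.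
Proof. by move=> n2; rewrite ltr0n -ltnS (ltn_predK (hp n2)) hp. Qed.

Let lnn_gt0 n : (2 <= n)%N -> 0 < ln n%:R :> R.
Proof. by move=> n2; rewrite ln_gt0// ltr1n. Qed.

Let t_range n : (2 <= n)%N -> 0 < t n < 1.
Proof.
move=> n2; rewrite /t /t_ expR_gt0/= -[ltRHS](@expR0 R) ltr_expR NE//.
by rewrite oppr_lt0 divr_gt0 ?N_gt0// mulr_gt0// lnn_gt0.
Qed.

Let t2E n : (2 <= n)%N -> t n ^+ 2 = expR (- (4 * ln n%:R / N n)).
Proof.
move=> n2; rewrite /t /t_ -expRM_natl NE//; congr expR; ring.
Qed.

(** The reason for the exponent in [t_]: the power occurring in the closed form is exactly n^(-4),
    and its square root matches the order n^2 of the number of pairs. *)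
Let t2X n : (2 <= n)%N -> (t n ^+ 2) ^+ (p n).-1 = (n%:R ^+ 4)^-1.
Proof.
move=> n2; rewrite t2E// -expRM_natl mulrN mulrCA -/(N n) mulfV ?gt_eqF ?N_gt0// mulr1.
by rewrite expRN mulrC expRM_natr lnK// posrE ltr0n (leq_trans _ n2).
Qed.

Let threshold_unfold n z : (2 <= n)%N ->
  threshold n z = sigma n + t n ^+ 2 / (2 * N n * sigma n) * (z - ln (K n)).
Proof.
move=> n2; rewrite /threshold /alpha_ -/(t n) NE// -/(sigma n); congr (_ + _ * _).
by rewrite mulrAC -expr2.
Qed.

Let N_infty C : \forall n \near \oo, C <= N n.
Proof.
near=> n; have n2 : (2 <= n)%N by near: n; exact: nbhs_infty_ge.
have pn : (p n).-1.+1 = p n by rewrite prednK// ltnW// hp.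
have : C + 1 <= (p n)%:R.
  near: n; exact: (p_infty (nbhs_infty_ger (C + 1))).
by rewrite -pn -natr1 lerD2r.
Unshelve. all: by end_near. Qed.

Let ln_infty (C : R) : \forall n \near \oo, C <= ln n%:R :> R.
Proof.
near=> n; have n0 : 0 < n%:R :> R by rewrite ltr0n; near: n; exact: nbhs_infty_gt.
rewrite -ler_expR lnK ?posrE//; near: n; exact: nbhs_infty_ger.
Unshelve. all: by end_near. Qed.

(** With v = 4 ln n / N, K = N (1 - e^(-v)) >= N v / (1 + v) = 4 ln n / (1 + v). So K is large as
    soon as N and ln n are, however they compare with each other. *)
Let K_infty C : \forall n \near \oo, C <= K n.
Proof.
near=> n.
have n2 : (2 <= n)%N by near: n; exact: nbhs_infty_ge.
have NC : 2 * (`|C| + 1) <= N n by near: n; exact: N_infty.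
have lC : `|C| + 1 <= ln n%:R by near: n; exact: ln_infty.
apply: (le_trans (ler_norm C)); have c0 := normr_ge0 C.
move: (`|C|) c0 NC lC => c c0 NC lC.
have Nn0 := N_gt0 n2; rewrite /K t2E// expRN.
set v := 4 * ln n%:R / N n.
have v0 : 0 <= v by rewrite divr_ge0 ?(ltW Nn0)// mulr_ge0// ltW// lnn_gt0.
have v1 : 0 < 1 + v by lra.
apply: (@le_trans _ _ (N n * (v / (1 + v)))); last first.
  rewrite ler_wpM2l ?(ltW Nn0)// lerBrDr -lerBrDl.
  have -> : 1 - v / (1 + v) = (1 + v)^-1 by field; rewrite gt_eqF.
  by rewrite lef_pV2 ?posrE ?expR_gt0// expR_ge1Dx.
rewrite mulrA ler_pdivlMr//.
have Nv : N n * v = 4 * ln n%:R by rewrite /v mulrC divfK// gt_eqF.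
have : c * v <= N n * v / 2 by nra.
lra.
Unshelve. all: by end_near. Qed.

Let r z n : R := (1 + `|z - ln (K n)|) ^+ 2 / K n.

(** The square of ln K is negligible against K. With k = ln K, K = (e^(k / 4))^4 >= (1 + k / 4)^4, a
    fourth power against the square (1 + |z - k|)^2 <= 16 A^2 (1 + k / 4)^2; the constant 64 is 4
    times this 16. *)
Let r_cvg0 z (e : R) : 0 < e -> \forall n \near \oo, r z n <= e.
Proof.
move=> e0; pose A := 1 + `|z|; have A0 : 0 < A by rewrite ltr_pwDl.
near=> n.
have K1 : 1 <= K n by near: n; exact: K_infty.
have K0 : 0 < K n by lra.
have Ke : expR (64 * A ^+ 2 / e) <= K n by near: n; exact: K_infty.
pose k := ln (K n).
have k0 : 0 <= k by rewrite ln_ge0.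
have ke : 64 * A ^+ 2 <= k * e.
  by rewrite -ler_pdivrMr// -ler_expR lnK.
rewrite /r -/k ler_pdivrMr//.
have KE : K n = expR (k / 4) ^+ 4 by rewrite -expRM_natl mulrC divfK// lnK.
have b1 : (1 + `|z - k|) ^+ 2 <= (A * (1 + k)) ^+ 2.
  rewrite ler_pXn2r ?nnegrE ?mulr_ge0 ?addr_ge0 ?(ltW A0)//.
  have := ler_normB z k; rewrite (ger0_norm k0) /A => h.
  have : 0 <= `|z| * k by rewrite mulr_ge0.
  lra.
have b2 : (1 + k / 4) ^+ 4 <= K n.
  rewrite KE ler_pXn2r ?nnegrE ?expR_ge0 ?expR_ge1Dx//; lra.
apply: (le_trans b1); apply: (@le_trans _ _ (e * (1 + k / 4) ^+ 4)); last first.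
  by rewrite ler_pM2l.
have c1 : (A * (1 + k)) ^+ 2 <= 16 * A ^+ 2 * (1 + k / 4) ^+ 2.
  have -> : 16 * A ^+ 2 * (1 + k / 4) ^+ 2 = (A * (4 + k)) ^+ 2 by field.
  rewrite ler_pXn2r ?nnegrE ?mulr_ge0 ?addr_ge0 ?(ltW A0)// ler_pM2l// lerD2r; lra.
apply: (le_trans c1); rewrite (exprD _ 2 2) mulrA ler_wpM2r ?sqr_ge0//.
have : k / 4 * e <= (1 + k / 4) ^+ 2 * e by rewrite ler_pM2r//; nra.
lra.
Unshelve. all: by end_near. Qed.

Let r_le z n : 0 < K n -> (1 + `|z - ln (K n)|) ^+ 2 <= r z n * K n.
Proof. by move=> K0; rewrite /r divfK// gt_eqF. Qed.

Let small_r z (e : R) : 0 < e -> \forall n \near \oo,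
  [/\ (2 <= n)%N, 0 < K n, r z n <= 1 / 4 & r z n <= e].
Proof.
move=> e0; near=> n; split.
- by near: n; exact: nbhs_infty_ge.
- by apply: (@lt_le_trans _ _ 1) => //; near: n; exact: K_infty.
- by near: n; apply: r_cvg0; lra.
- by near: n; exact: r_cvg0.
Unshelve. all: by end_near. Qed.

Lemma threshold_range_near z : \forall n \near \oo, 0 < threshold n z < 1.
Proof.
near=> n; have [n2 K0 r4 _] : [/\ (2 <= n)%N, 0 < K n, r z n <= 1 / 4 & r z n <= 1].
  by near: n; exact: small_r.
have /andP[t0 t1] := t_range n2; rewrite threshold_unfold//.
have N0 : (0 < (p n).-1)%N by rewrite -(ltr0n R) N_gt0.
exact: threshold_range t0 t1 N0 (r_le z K0) r4.
Unshelve. all: by end_near. Qed.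

Lemma threshold_ratio_cvg z : threshold n z / sigma n @[n --> \oo] --> (1 : R).
Proof.
apply/cvgrPdist_le => e e0; near=> n.
have [n2 K0 r4 re] : [/\ (2 <= n)%N, 0 < K n, r z n <= 1 / 4 & r z n <= e].
  by near: n; exact: small_r.
have /andP[t0 t1] := t_range n2; rewrite threshold_unfold//.
have s0 : 0 < sigma n by rewrite sqrtr_gt0 subr_gt0 exprn_ilt1// ltW.
have N0 : (0 < (p n).-1)%N by rewrite -(ltr0n R) N_gt0.
have := threshold_ratio_bounds t0 t1 N0 (r_le z K0).
rewrite -/(sigma n) -/(N n) -(ler_pdivlMr _ _ s0) -(ler_pdivrMr _ _ s0).
have rn0 : 0 <= r z n by rewrite divr_ge0 ?sqr_ge0// ltW.
by move: (_ / sigma n) => q /andP[q1 q2]; rewrite ler_norml; lra.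
Unshelve. all: by end_near. Qed.

Let Q z n : R := (1 - threshold n z ^+ 2) ^+ (p n).-1 *
  expR (z - ln (K n)) * n%:R ^+ 4.

Let Q_cvg z : Q z n @[n --> \oo] --> (1 : R).
Proof.
apply/cvgrPdist_le => e e0; have e3 : 0 < e / 3 by rewrite divr_gt0.
near=> n.
have [n2 K0 r4 re] : [/\ (2 <= n)%N, 0 < K n, r z n <= 1 / 4 & r z n <= e / 3].
  by near: n; exact: small_r.
have /andP[t0 t1] := t_range n2; rewrite /Q threshold_unfold//.
have N0 : (0 < (p n).-1)%N by rewrite -(ltr0n R) N_gt0.
have := weight_bounds t0 t1 N0 (r_le z K0) r4.
rewrite t2X// invrK -/(sigma n) -/(N n) => /andP[q1 q2].
have := expR_ge1Dx (- (3 * r z n)); rewrite ler_norml; lra.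
Unshelve. all: by end_near. Qed.

Section cap_tail.
Variables (h : nat -> R) (F : nat -> R -> R).
Hypothesis h_ge0 : forall n, (2 <= n)%N -> 0 <= h n.
Hypothesis h_bounds : forall n, (2 <= n)%N ->
  1 <= 2 * pi * (p n)%:R * h n ^+ 2 <= 1 + (p n)%:R^-1.

(** n^2 H(s) / s at the threshold, with [h n] for H(0). Both h and F are abstract because the upper
    and the lower tail of a coordinate are each substituted for F. *)
Let G z n : R := n%:R ^+ 2 * (h n * Num.sqrt (1 - threshold n z ^+ 2) ^+ (p n).-1 /
  threshold n z).

(** This is e^(- z / 2) / sqrt(2 pi), written as the square root of the limit of [G z n ^+ 2]. *)
Definition cap_rate (z : R) : R := Num.sqrt (expR (- z) / (2 * pi)).

(** Squaring removes the square roots. Every factor on the right except [expR (- z) / (2 * pi)]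
    tends to 1. *)
Let G_sqr z n : (2 <= n)%N -> 0 < K n -> 0 < threshold n z < 1 ->
  G z n ^+ 2 = expR (- z) / (2 * pi) * (2 * pi * (p n)%:R * h n ^+ 2) *
    (N n / (p n)%:R) * Q z n * (threshold n z / sigma n) ^- 2.
Proof.
move=> n2 K0 /andP[s0 s1].
have p0 : 0 < (p n)%:R :> R by rewrite ltr0n (leq_trans _ (hp n2)).
have pi0 := pi_gt0 R.
rewrite /G !exprMn exprVn -!exprM mulnC [in X in h n ^+ 2 * X]exprM sqr_sqrtr; last first.
  by rewrite subr_ge0 exprn_ile1// ltW.
have -> : expR (- z) = expR (- (z - ln (K n))) / K n.
  by rewrite opprB expRD lnK// mulrAC mulfV ?mul1r// gt_eqF.
rewrite /Q expRN; set w := expR (z - _).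
have w0 : w != 0 by rewrite gt_eqF// expR_gt0.
set X := (1 - _) ^+ _; rewrite /K.
have /andP[t0 t1] := t_range n2.
have t20 : 0 < 1 - t n ^+ 2 by rewrite subr_gt0 exprn_ilt1// ltW.
have sg0 : sigma n != 0 by rewrite gt_eqF// sqrtr_gt0.
have -> : 1 - t n ^+ 2 = sigma n ^+ 2 by rewrite sqr_sqrtr// ltW.
have N0 : (p n).-1%:R != 0 :> R by rewrite gt_eqF// N_gt0.
move: (pi : R) pi0 => c c0; field.
by rewrite sg0 N0 w0 !gt_eqF.
Qed.

Let G_cvg z : G z n @[n --> \oo] --> cap_rate z.
Proof.
have A_cvg : 2 * pi * (p n)%:R * h n ^+ 2 @[n --> \oo] --> (1 : R).
  apply/cvgrPdist_le => e e0; near=> n.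
  have n2 : (2 <= n)%N by near: n; exact: nbhs_infty_ge.
  have Ne : e^-1 <= N n by near: n; exact: N_infty.
  have := h_bounds n2; have : (p n)%:R^-1 <= e.
    have Np : N n <= (p n)%:R by rewrite ler_nat leq_pred.
    have p0 : 0 < (p n)%:R :> R by rewrite ltr0n (leq_trans _ (hp n2)).
    by rewrite -[leRHS]invrK lef_pV2 ?posrE ?invr_gt0//; exact: le_trans Ne Np.
  move: (_ * h n ^+ 2) => a; rewrite ler_norml; lra.
have B_cvg : N n / (p n)%:R @[n --> \oo] --> (1 : R).
  apply/cvgrPdist_le => e e0; near=> n.
  have n2 : (2 <= n)%N by near: n; exact: nbhs_infty_ge.
  have Ne : e^-1 <= N n by near: n; exact: N_infty.
  have p0 : 0 < (p n)%:R :> R by rewrite ltr0n (leq_trans _ (hp n2)).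
  have : (p n)%:R^-1 <= e.
    have Np : N n <= (p n)%:R by rewrite ler_nat leq_pred.
    by rewrite -[leRHS]invrK lef_pV2 ?posrE ?invr_gt0//; exact: le_trans Ne Np.
  have -> : N n / (p n)%:R = 1 - (p n)%:R^-1.
    by rewrite -NE//; field; rewrite gt_eqF.
  by have : 0 < (p n)%:R^-1 :> R by [rewrite invr_gt0]; rewrite ler_norml; lra.
have R_cvg : (threshold n z / sigma n) ^- 2 @[n --> \oo] --> (1 : R).
  have -> : (1 : R) = 1 ^- 2 by rewrite expr1n invr1.
  apply: cvgV; first by rewrite expr1n oner_neq0.
  rewrite expr2; under eq_fun do rewrite expr2.
  by apply: cvgM; exact: threshold_ratio_cvg.
have sqr_cvg : G z n ^+ 2 @[n --> \oo] --> expR (- z) / (2 * pi).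
  have : expR (- z) / (2 * pi) * (2 * pi * (p n)%:R * h n ^+ 2) *
    (N n / (p n)%:R) * Q z n * (threshold n z / sigma n) ^- 2 @[n --> \oo] -->
    expR (- z) / (2 * pi) * 1 * 1 * 1 * (1 : R).
    apply: cvgM => //; apply: cvgM; last exact: Q_cvg.
    by apply: cvgM => //; apply: cvgM => //; exact: cvg_cst.
  rewrite !mulr1; apply: cvg_trans; apply: near_eq_cvg; near=> n.
  rewrite G_sqr//.
  - by near: n; exact: nbhs_infty_ge.
  - by apply: (@lt_le_trans _ _ 1) => //; near: n; exact: K_infty.
  - by near: n; exact: threshold_range_near.
have S_cvg : Num.sqrt (G z n ^+ 2) @[n --> \oo] --> cap_rate z.
  exact: (continuous_cvg _ (@sqrt_continuous R (expR (- z) / (2 * pi))) sqr_cvg).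
apply: cvg_trans S_cvg; apply: near_eq_cvg; near=> n.
have n2 : (2 <= n)%N by near: n; exact: nbhs_infty_ge.
have /andP[s0 s1] : 0 < threshold n z < 1 by near: n; exact: threshold_range_near.
rewrite sqrtr_sqr ger0_norm// /G mulr_ge0// ?sqr_ge0// divr_ge0 ?(ltW s0)//.
by rewrite mulr_ge0 ?h_ge0// exprn_ge0// sqrtr_ge0.
Unshelve. all: by end_near. Qed.

Hypothesis F_lower : forall n s s', (2 <= n)%N -> 0 <= s -> s < s' -> s' < 1 ->
  h n * Num.sqrt (1 - s ^+ 2) ^+ (p n).-1 - h n * Num.sqrt (1 - s' ^+ 2) ^+ (p n).-1
    <= s' * F n s.
Hypothesis F_upper : forall n s, (2 <= n)%N -> 0 < s -> s < 1 ->
  s * F n s <= h n * Num.sqrt (1 - s ^+ 2) ^+ (p n).-1.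

Let threshold_lt n z z' : (2 <= n)%N -> z < z' -> threshold n z < threshold n z'.
Proof.
move=> n2 zz'; have /andP[t0 t1] := t_range n2.
rewrite !threshold_unfold// ltrD2l ltr_pM2l ?ltrD2r//.
rewrite divr_gt0 ?exprn_gt0// !mulr_gt0 ?N_gt0//.
by rewrite sqrtr_gt0 subr_gt0 exprn_ilt1// ltW.
Qed.

Let cap_rate_small z (e : R) : 0 < e -> exists2 M, 0 < M & cap_rate (z + M) <= e.
Proof.
move=> e0; have pi0 := pi_gt0 R; have c0 : 0 < 2 * pi * e ^+ 2 by rewrite !mulr_gt0// exprn_gt0.
pose M := `|- z - ln (2 * pi * e ^+ 2)| + 1.
have M1 : - z - ln (2 * pi * e ^+ 2) <= M by rewrite (le_trans (ler_norm _))// lerDl.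
exists M; first by rewrite ltr_wpDl.
rewrite -[leRHS]gtr0_norm// -sqrtr_sqr ler_sqrt ?sqr_ge0//.
rewrite ler_pdivrMr ?mulr_gt0// [leRHS]mulrC -[leRHS]lnK ?posrE// ler_expR; lra.
Qed.

(** G z n is an upper bound. For the lower one take s' at z + M: for fixed M the ratio s' / s tends
    to 1, while the subtracted term tends to [cap_rate (z + M)], which is small for large M. *)
Lemma tail_cvg z : n%:R ^+ 2 * F n (threshold n z) @[n --> \oo] --> cap_rate z.
Proof.
apply/cvgrPdist_le => e e0; have e4 : 0 < e / 4 by rewrite divr_gt0.
have [M M0 LM] := cap_rate_small z e4.
have GM := @G_cvg (z + M).
have Gz := @G_cvg z.
have rho : G z n * (threshold n z / sigma n) / (threshold n (z + M) / sigma n)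
    @[n --> \oo] --> cap_rate z.
  rewrite -[X in _ --> X]mulr1 -[X in _ --> X]divr1.
  apply: cvgM; first by apply: cvgM => //; exact: threshold_ratio_cvg.
  by apply: cvgV; [exact: oner_neq0|exact: threshold_ratio_cvg].
near=> n.
have n2 : (2 <= n)%N by near: n; exact: nbhs_infty_ge.
have /andP[s0 s1] : 0 < threshold n z < 1 by near: n; exact: threshold_range_near.
have /andP[s'0 s'1] : 0 < threshold n (z + M) < 1.
  by near: n; exact: threshold_range_near.
have ss' : threshold n z < threshold n (z + M) by apply: threshold_lt; rewrite ?ltrDl.
have h1 : `|cap_rate z - G z n| <= e / 4 by near: n; exact: cvgr_dist_le.
have h2 : `|cap_rate (z + M) - G (z + M) n| <= e / 4 by near: n; exact: cvgr_dist_le.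
have h3 : `|cap_rate z - G z n * (threshold n z / sigma n) /
    (threshold n (z + M) / sigma n)| <= e / 4 by near: n; exact: cvgr_dist_le.
have /andP[t0 t1] := t_range n2.
have sg0 : 0 < sigma n by rewrite sqrtr_gt0 subr_gt0 exprn_ilt1// ltW.
have n20 : 0 <= n%:R ^+ 2 :> R by rewrite sqr_ge0.
have up : n%:R ^+ 2 * F n (threshold n z) <= G z n.
  by rewrite /G ler_wpM2l// ler_pdivlMr// mulrC F_upper.
have low : G z n * (threshold n z / sigma n) / (threshold n (z + M) / sigma n) -
    G (z + M) n <= n%:R ^+ 2 * F n (threshold n z).
  have := F_lower n2 (ltW s0) ss' s'1; rewrite [leRHS]mulrC -(ler_pdivrMr _ _ s'0) => lo.
  apply: (@le_trans _ _ _ _ _ _ (ler_wpM2l n20 lo)).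
  by rewrite /G le_eqVlt; apply/orP; left; apply/eqP; field; rewrite !gt_eqF.
by move: h1 h2 h3 up low; rewrite !ler_norml; lra.
Unshelve. all: by end_near. Qed.

End cap_tail.

End threshold_limits.

(** * Independence of the scalar products *)

Section independent_tuple.
Context d (T : measurableType d) (R : realType) (P : probability T R).
Context d' (V : measurableType d') (n : nat).

(** A generating pi-system: mutual independence yields the product formula on boxes, and
    [independent_of_boxes] extends it by Dynkin's lemma with the other event fixed. *)
Definition boxes : set (set (n.-tuple V)) :=
  [set C | exists2 B : 'I_n -> set V, (forall k, measurable (B k)) &
    C = \bigcap_k [set w | B k (tnth w k)]].

Lemma measurable_tuple_boxes : @measurable _ (n.-tuple V) = <<s boxes >>.
Proof.
apply/seteqP; split.
  apply: sub_sigma_algebra2 => C; rewrite -bigcup_seq/= => -[k _ [B mB <-]].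
  exists (fun l => if l == k then B else setT).
    by move=> l; case: eqP.
  rewrite setTI; apply/seteqP; split => [w Bw l _ /=|w /(_ k I)/=].
    by case: eqP => [->|].
  by rewrite eqxx.
apply: smallest_sub; first exact: sigma_algebra_measurable.
move=> C [B mB ->]; apply: fin_bigcap_measurable; first exact: finite_finset.
move=> k _; rewrite -[X in measurable X]setTI.
exact: (@measurable_tnth _ V n k).
Qed.

Lemma setI_closed_boxes : setI_closed boxes.
Proof.
move=> _ _ [B mB ->] [B' mB' ->]; exists (fun k => B k `&` B' k).
  by move=> k; exact: measurableI.
by rewrite -bigcapI.
Qed.

Lemma independent_of_boxes (W : T -> n.-tuple V) (E : set T) :
  measurable_fun setT W -> measurable E ->
  (forall B : 'I_n -> set V, (forall k, measurable (B k)) ->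
    P ((\bigcap_k [set t | B k (tnth (W t) k)]) `&` E) =
    P (\bigcap_k [set t | B k (tnth (W t) k)]) * P E)%E ->
  forall C, measurable C -> P (W @^-1` C `&` E) = (P (W @^-1` C) * P E)%E.
Proof.
move=> mW mE box C mC; have mWC A : measurable A -> measurable (W @^-1` A).
  by move=> mA; rewrite -[X in measurable X]setTI; exact: mW.
have PE : P E \is a fin_num by exact: fin_num_measure.
apply: (dynkin_induction (P := fun C => P (W @^-1` C `&` E) = (P (W @^-1` C) * P E)%E)
  measurable_tuple_boxes setI_closed_boxes).
- by rewrite preimage_setT setTI probability_setT mul1e.
- by move=> _ [B mB ->]; rewrite preimage_bigcap; exact: box.
- move=> S mS PS; rewrite preimage_setC probability_setC; last exact: mWC.
  have -> : ~` (W @^-1` S) `&` E = E `\` (W @^-1` S `&` E).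
    by apply/seteqP; split=> t /=; tauto.
  have mI : measurable (W @^-1` S `&` E) by apply: measurableI => //; exact: mWC.
  have Py : (P E < +oo)%E by rewrite ltey_eq PE.
  transitivity (P E - P (W @^-1` S) * P E)%E.
    rewrite -PS measureD//; congr (_ - P _)%E.
    by rewrite setICA setIid.
  have PW : P (W @^-1` S) \is a fin_num by exact/fin_num_measure/mWC.
  rewrite -(fineK PE) -(fineK PW).
  by rewrite -EFinM -EFinB -EFinM mulrBl mul1r.
- move=> F mF tF PF; rewrite preimage_bigcup setI_bigcupl.
  have tW : trivIset setT (fun k => W @^-1` F k).
    by move=> k l _ _ [t [Fk Fl]]; apply: tF => //; exists (W t).
  have mWF k : measurable (W @^-1` F k) by exact: mWC.
  rewrite !measure_semi_bigcup//; last 4 first.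
  + exact: bigcup_measurable.
  + by move=> k; exact: measurableI.
  + exact: trivIset_setIr.
  + by apply: bigcup_measurable => k _; exact: measurableI.
  rewrite -(fineK PE) muleC -nneseriesZl//; apply: eq_eseriesr => k _.
  by rewrite fineK// muleC; exact: PF.
- by rewrite -measurable_tuple_boxes.
Qed.

End independent_tuple.

(** The reflection along x - e_i exchanges the unit vectors x and e_i, so <x, y> is the i-th
    coordinate of the image of y. For x = e_i it is the identity. *)
Lemma uniform_dotp_law (R : realType) (p : nat) (nu : probability (p.-tuple R) R)
    (i : 'I_p) (x : p.-tuple R) (A : set R) :
  uniform_on_sphere nu -> unit_sphere x -> measurable A ->
  nu [set y | A (dotp x y)] = nu [set y | A (tnth y i)].
Proof.
move=> nu_unif Sx mA.
pose e : p.-tuple R := [tuple (k == i)%:R | k < p].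
have de y : dotp e y = tnth y i.
  rewrite /dotp (bigD1 i)//= tnth_mktuple eqxx mul1r big1 ?addr0// => k /negbTE kj.
  by rewrite tnth_mktuple kj mul0r.
have xx : dotp x x = 1 by move: Sx; rewrite unit_sphereE.
pose w : p.-tuple R := [tuple tnth x k - tnth e k | k < p].
have dw y : dotp w y = dotp x y - tnth y i.
  rewrite -de /dotp -sumrB; apply: eq_bigr => k _.
  by rewrite tnth_mktuple mulrBl.
have wi : tnth w i = tnth x i - 1 by rewrite !tnth_mktuple eqxx mulr1n.
have ww : dotp w w = 2 * (1 - tnth x i) by rewrite dw dotpC dw wi xx; ring.
have key y : tnth (reflection w y) i = dotp x y.
  rewrite tnth_reflection dw ww wi.
  have [xi1|xi1] := eqVneq (tnth x i) 1; last by field; rewrite subr_eq0 eq_sym.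
  have {}ww : dotp w w = 0 by rewrite ww xi1 subrr mulr0.
  have w0 k : tnth w k = 0.
    move/eqP: ww; rewrite /dotp psumr_eq0; last by move=> l _; rewrite -expr2 sqr_ge0.
    by move=> /allP/(_ k (mem_index_enum _)); rewrite -expr2 sqrf_eq0 => /eqP.
  have : dotp w y = 0 by apply: big1 => k _; rewrite w0 mul0r.
  by rewrite dw xi1 subrr !mulr0 subr0 => /eqP; rewrite subr_eq0 => /eqP.
rewrite -(nu_unif.2 _ (orthogonal_reflection_mx w) [set y | A (tnth y i)]).
  rewrite mxact_reflection; congr (nu _).
  by apply/seteqP; split => y /=; rewrite key.
exact: measurable_tnth_preimage.
Qed.

Section pair_independence.
Context d (T : measurableType d) (R : realType) (P : probability T R).
Context (n p : nat) (X : 'I_n -> {RV P >-> p.-tuple R}).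
Hypothesis X_indep : mutually_independent X.
Hypothesis X_unif : forall i, uniform_on_sphere (distribution P (X i)).
Variables (c : 'I_p) (A : set R).
Hypothesis mA : measurable A.

Let V : measurableType _ := p.-tuple R.

Let mX i : measurable_fun setT (X i : T -> V).
Proof. exact: measurable_funPT. Qed.

(** The configuration without X_j; the zero vector at place j keeps the indices of the others
    unchanged. *)
Definition forget (j : 'I_n) (t : T) : n.-tuple V :=
  [tuple if k == j then [tuple 0 | _ < p] else X k t | k < n].

Lemma tnth_forget j t k : k != j -> tnth (forget j t) k = X k t.
Proof. by move=> /negbTE kj; rewrite tnth_mktuple kj. Qed.

Lemma measurable_forget j : measurable_fun setT (forget j).
Proof.
apply/measurable_fun_tnthP => k.
rewrite (_ : _ \o _ = if k == j then cst [tuple 0 | _ < p] else X k : T -> V); last first.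
  by apply/funext => t /=; rewrite tnth_mktuple; case: eqP.
by case: eqP => _; [exact: measurable_cst|exact: mX].
Qed.

Let forget_indep j (B : set V) (C : set (n.-tuple V)) :
  measurable B -> measurable C ->
  (P (forget j @^-1` C `&` X j @^-1` B) = P (forget j @^-1` C) * P (X j @^-1` B))%E.
Proof.
move=> mB mC; apply: independent_of_boxes => //; first exact: measurable_forget.
  by rewrite -[X in measurable X]setTI; exact: mX.
move=> D mD.
(* Place j of the tuple is constant, so the box is either empty or imposes nothing there; in the
   second case this place is free to carry the event on X_j. *)
have [D0|D0] := pselect (D j [tuple 0 | _ < p]); last first.
  have -> : \bigcap_k [set t | D k (tnth (forget j t) k)] = set0.
    by apply/seteqP; split => t // /(_ j I)/=; rewrite tnth_mktuple eqxx.
  by rewrite set0I measure0 mul0e.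
have -> : \bigcap_k [set t | D k (tnth (forget j t) k)] =
    \bigcap_(k in [set` [set k | k != j]%SET]) (X k @^-1` D k).
  apply/seteqP; split => t Dt k.
    by rewrite /= inE => kj; have := Dt k I; rewrite /= tnth_mktuple (negbTE kj).
  move=> _ /=; rewrite tnth_mktuple; case: eqP => [->//|/eqP kj].
  by apply: (Dt k); rewrite /= inE.
pose D' k := if k == j then B else D k.
have mD' k : measurable (D' k) by rewrite /D'; case: eqP.
have -> : \bigcap_(k in [set` [set k | k != j]%SET]) (X k @^-1` D k) `&` X j @^-1` B =
    \bigcap_(k in [set` [set: 'I_n]%SET]) (X k @^-1` D' k).
  apply/seteqP; split => t.
    move=> [Dt Bt] k _; rewrite /= /D'; case: eqP => [->//|/eqP kj].
    by apply: (Dt k); rewrite /= inE.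
  move=> Dt; split.
    by move=> k; rewrite /= inE => kj; have := Dt k; rewrite /= inE /D' (negbTE kj); apply.
  by have := Dt j; rewrite /= inE /D' eqxx; apply.
rewrite !X_indep// (bigD1 j) ?inE//= muleC /D' eqxx; congr (_ * _)%E.
by apply: eq_big => k; rewrite ?inE// => /negbTE ->.
Qed.

Let q (j : 'I_n) := distribution P (X j) [set y | A (tnth y c)].

(** By Fubini: once the other vectors are fixed, X_i is a fixed unit vector, and the law of its
    product with X_j does not depend on which one it is. *)
Lemma forget_dotp (i j : 'I_n) (C : set (n.-tuple V)) : i != j -> measurable C ->
  P (forget j @^-1` C `&` [set t | A (dotp (X i t) (X j t))]) =
  (P (forget j @^-1` C) * q j)%E.
Proof.
move=> ij mC; pose S : set V := @unit_sphere R p.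
have mS : measurable S by exact: measurable_unit_sphere.
pose mW : {RV P >-> n.-tuple V} := HB.pack (forget j)
  (isMeasurableFun.Build _ _ _ _ (forget j) (measurable_forget j)).
pose m1 := distribution P mW; pose m2 := distribution P (X j).
pose Z t := (forget j t, X j t).
have mZ : measurable_fun setT Z by apply: measurable_fun_pair; [exact: measurable_forget|exact: mX].
pose mZ' : {RV P >-> (n.-tuple V * V)%type} := HB.pack Z
  (isMeasurableFun.Build _ _ _ _ Z mZ).
pose D := [set u : n.-tuple V * V | C u.1 /\ A (dotp (tnth u.1 i) u.2)].
have mD : measurable D.
  have -> : D = (fst @^-1` C) `&` ((fun u => dotp (tnth u.1 i) u.2) @^-1` A) by [].
  apply: measurableI; rewrite -[X in measurable X]setTI.
    exact: measurable_fst.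
  apply: measurable_dotp => //; apply: (measurableT_comp (@measurable_tnth _ V n i)).
  exact: measurable_fst.
have joint (B1 : set (n.-tuple V)) (B2 : set V) : measurable B1 -> measurable B2 ->
    distribution P mZ' (B1 `*` B2) = (m1 B1 * m2 B2)%E.
  by move=> mB1 mB2; exact: forget_indep.
have <- : (m1 \x m2)%E D =
    P (forget j @^-1` C `&` [set t | A (dotp (X i t) (X j t))]).
  apply: (etrans (@product_measure_unique _ _ _ _ R m1 m2 (distribution P mZ') joint D mD)).
  transitivity (P (Z @^-1` D)); first by [].
  by congr (P _); apply/seteqP; split => t /=; rewrite /D/= tnth_mktuple (negbTE ij).
rewrite /product_measure1.
transitivity (\int[m1]_w ((\1_C w)%:E * q j))%E; last first.
  rewrite ge0_integralZr//; first by rewrite integral_indic// setIT.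
  by apply/measurable_EFinP; exact: measurable_indic.
apply: ae_eq_integral => //.
- exact: (measurable_fun_xsection m2 mD).
- by apply: emeasurable_funM => //; apply/measurable_EFinP; exact: measurable_indic.
(* X_i lies on the sphere only almost surely, so the two integrands are compared outside this null
   set. *)
pose N := [set w : n.-tuple V | ~ S (tnth w i)].
have mN : measurable N.
  have -> : N = (fun w => tnth w i) @^-1` (~` S) by [].
  rewrite -[X in measurable X]setTI; apply: (@measurable_tnth _ V n i) => //.
  exact: measurableC.
exists N; split => //.
  transitivity (distribution P (X i) (~` S)); last first.
    by rewrite probability_setC// (X_unif i).1 subee.
  transitivity (P (forget j @^-1` N)); first by [].
  by congr (P _); apply/seteqP; split => t /=; rewrite /N/= tnth_mktuple (negbTE ij).
move=> w; apply: contra_notP => Sw _ /=.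
have Swi : unit_sphere (tnth w i) by apply: contrapT.
rewrite indicE; have [wC|wC] := boolP (w \in C); last first.
  rewrite mul0e (_ : xsection D w = set0) ?measure0//.
  by apply/seteqP; split => y //; rewrite /xsection/= inE => -[/mem_set]; rewrite (negbTE wC).
rewrite mul1e /q -(uniform_dotp_law c (X_unif j) Swi mA); congr (m2 _).
apply/seteqP; split => y; rewrite /xsection/= inE; first by case.
by move=> ?; split => //; exact: set_mem.
Qed.

End pair_independence.

(** * Adding the vectors one at a time *)

Section recursion.
Context (R : realType).

Lemma expRN_le (x : R) : 0 <= x -> x <= 1 -> `|expR (- x) - (1 - x)| <= x ^+ 2.
Proof.
move=> x0 x1; have h1 := expR_ge1Dx (- x).
rewrite ger0_norm; last by lra.
suff : expR (- x) <= 1 - x + x ^+ 2 by lra.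
rewrite expRN; apply: (@le_trans _ _ (1 + x)^-1).
  by rewrite lef_pV2 ?posrE ?expR_gt0 ?expR_ge1Dx//; lra.
rewrite -[leLHS]mul1r ler_pdivrMr; last by lra.
have : 0 <= x * x ^+ 2 by rewrite mulr_ge0// sqr_ge0.
lra.
Qed.

(** The comparison sequence satisfies e_(m + 1) = e_m exp(- m Q). Each step adds at most m^2 Q^2
    from the recursion and as much from exp(- x) = 1 - x + O(x^2); as 0 <= 1 - m Q <= 1, earlier
    errors are not amplified. *)
Lemma recursion_expR (a : nat -> R) (Q : R) (n : nat) : 0 <= Q -> n%:R * Q <= 1 ->
  a 0 = 1 -> (forall m, (m < n)%N ->
    0 <= a m.+1 - a m * (1 - m%:R * Q) <= m%:R ^+ 2 * Q ^+ 2) ->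
  `|a n - expR (- (Q * (n%:R * (n%:R - 1) / 2)))| <= 2 * n%:R ^+ 3 * Q ^+ 2.
Proof.
move=> Q0 nQ a0 rec.
pose e m := expR (- (Q * (m%:R * (m%:R - 1) / 2))).
suff : forall m, (m <= n)%N -> `|a m - e m| <= m%:R * (2 * n%:R ^+ 2 * Q ^+ 2).
  move=> /(_ n (leqnn n)) h; apply: (le_trans h).
  by rewrite le_eqVlt; apply/orP; left; apply/eqP; ring.
elim=> [_|m IH mn].
  by rewrite a0 /e mul0r mul0r mulr0 oppr0 expR0 subrr normr0 mul0r.
have {}IH := IH (ltnW mn).
have mnR : m%:R <= n%:R :> R by rewrite ler_nat ltnW.
have m0 : 0 <= m%:R :> R by exact: ler0n.
have x0 : 0 <= m%:R * Q by rewrite mulr_ge0.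
have x1 : m%:R * Q <= 1 by rewrite (le_trans _ nQ)// ler_wpM2r.
have eS : e m.+1 = e m * expR (- (m%:R * Q)).
  by rewrite /e -expRD -natr1; congr expR; field.
have e1 : e m <= 1.
  rewrite /e -[leRHS]expR0 ler_expR oppr_le0 mulr_ge0// divr_ge0//.
  by case: m m0 {IH mn mnR x0 x1 eS} => [|m] m0; [rewrite mul0r|rewrite -natr1 addrK mulr_ge0].
have e0 : 0 <= e m by exact: expR_ge0.
have mnQ : m%:R ^+ 2 * Q ^+ 2 <= n%:R ^+ 2 * Q ^+ 2.
  by rewrite ler_wpM2r ?sqr_ge0// ler_pXn2r// nnegrE ler0n.
have /andP[r0 r1] := rec m mn.
have d1 : `|(a m - e m) * (1 - m%:R * Q)| <= `|a m - e m|.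
  rewrite normrM ler_piMr// ger0_norm; lra.
have d2 : `|e m * (expR (- (m%:R * Q)) - (1 - m%:R * Q))| <= m%:R ^+ 2 * Q ^+ 2.
  rewrite normrM (ger0_norm e0) -[leRHS]mul1r ler_pM// -exprMn; exact: expRN_le.
have -> : m.+1%:R = m%:R + 1 :> R by rewrite -natr1.
have -> : a m.+1 - e m.+1 = (a m.+1 - a m * (1 - m%:R * Q)) +
    ((a m - e m) * (1 - m%:R * Q) - e m * (expR (- (m%:R * Q)) - (1 - m%:R * Q))).
  by rewrite eS; ring.
rewrite (le_trans (ler_normD _ _))// (ger0_norm r0).
have := ler_normB ((a m - e m) * (1 - m%:R * Q))
  (e m * (expR (- (m%:R * Q)) - (1 - m%:R * Q))).
lra.
Qed.

End recursion.

Section fine_probability.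
Context d (T : measurableType d) (R : realType) (P : probability T R).
Implicit Types E F : set T.

Definition prob E : R := fine (P E).

Lemma prob_ge0 E : 0 <= prob E. Proof. by rewrite fine_ge0. Qed.

Lemma prob_le E F : measurable E -> measurable F -> E `<=` F -> prob E <= prob F.
Proof.
by move=> mE mF EF; rewrite fine_le ?fin_num_measure// le_measure ?inE.
Qed.

Lemma probD E F : measurable E -> measurable F ->
  prob (E `\` F) = prob E - prob (E `&` F).
Proof.
move=> mE mF; rewrite /prob measureD ?fineB ?fin_num_measure//.
  by apply: measurableI.
by rewrite ltey_eq fin_num_measure.
Qed.

Lemma prob_setU_le E F : measurable E -> measurable F ->
  prob (E `|` F) <= prob E + prob F.
Proof.
move=> mE mF; rewrite /prob -fineD ?fin_num_measure// fine_le ?fin_num_measure//.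
- exact: measurableU.
- by rewrite fin_numD !fin_num_measure.
- exact: measureU2.
Qed.

End fine_probability.

Section no_bad_pair.
Context d (T : measurableType d) (R : realType) (P : probability T R).
Context (n p : nat) (X : 'I_n -> {RV P >-> p.-tuple R}).
Hypothesis X_indep : mutually_independent X.
Hypothesis X_unif : forall i, uniform_on_sphere (distribution P (X i)).
Variables (c : 'I_p) (A : set R).
Hypothesis mA : measurable A.

Let V : measurableType _ := p.-tuple R.

Let mX i : measurable_fun setT (X i : T -> V).
Proof. exact: measurable_funPT. Qed.

Let bad (i j : 'I_n) : set T := [set t | A (dotp (X i t) (X j t))].

Let measurable_dotp_preimage d' (U : measurableType d') (f g : U -> V) :
  measurable_fun setT f -> measurable_fun setT g ->
  measurable [set u | A (dotp (f u) (g u))].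
Proof.
move=> mf mg; rewrite -[X in measurable X]setTI.
exact: (measurable_dotp mf mg).
Qed.

Let measurable_bad i j : measurable (bad i j).
Proof. exact: measurable_dotp_preimage. Qed.

(** Stated over an arbitrary space so that the event can be read both on the sample space and on the
    tuples produced by [forget]. *)
Let no_pair (U : Type) (f : 'I_n -> U -> V) (m : nat) : set U :=
  [set u | forall i j : 'I_n, (i < j)%N -> (j < m)%N -> ~ A (dotp (f i u) (f j u))].

Let measurable_no_pair d' (U : measurableType d') (f : 'I_n -> U -> V) m :
  (forall i, measurable_fun setT (f i)) -> measurable (no_pair f m).
Proof.
move=> mf; pose G (i j : 'I_n) := if (i < j)%N && (j < m)%N then
  ~` [set u | A (dotp (f i u) (f j u))] else setT.
have -> : no_pair f m = \bigcap_i \bigcap_j G i j.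
  apply/seteqP; split => u h i; last first.
    by move=> j ij jm; have := h i I j I; rewrite /G ij jm.
  by move=> _ j _; rewrite /G; case: ifP => // /andP[ij jm]; exact: h.
apply: fin_bigcap_measurable; first exact: finite_finset.
move=> i _; apply: fin_bigcap_measurable; first exact: finite_finset.
move=> j _; rewrite /G; case: ifP => // _; apply: measurableC.
exact: measurable_dotp_preimage.
Qed.

Definition good (m : nat) : set T := no_pair (fun i => X i) m.

Let measurable_good m : measurable (good m).
Proof. exact: measurable_no_pair. Qed.

Let Q (j : 'I_n) : R := fine (distribution P (X j) [set y | A (tnth y c)]).

Let prob_forget (i j : 'I_n) (C : set (n.-tuple V)) : i != j -> measurable C ->
  prob P (forget X j @^-1` C `&` bad i j) = prob P (forget X j @^-1` C) * Q j.
Proof.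
move=> ij mC; rewrite /prob (forget_dotp X_indep X_unif c mA ij mC) fineM//.
  apply: fin_num_measure; rewrite -[X in measurable X]setTI.
  exact: measurable_forget.
by apply: fin_num_measure; exact: measurable_tnth_preimage.
Qed.

Let bad_sym i j : bad i j = bad j i.
Proof. by apply/seteqP; split => t; rewrite /bad/= dotpC. Qed.

Let prob_bad i j : i != j -> prob P (bad i j) = Q j.
Proof.
move=> ij; have := prob_forget ij measurableT.
by rewrite preimage_setT setTI /prob probability_setT mul1r.
Qed.

(* Both sides are the probability of the symmetric event [bad i j]. *)
Let Q_eq i j : Q i = Q j.
Proof.
have [->//|ij] := eqVneq i j.
by rewrite -(prob_bad ij) bad_sym prob_bad// eq_sym.
Qed.

(** The vector to forget is X_i', not the common X_j: [bad i j] is then an event of the remaining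
    vectors, and [bad i' j] a scalar product of one of them with X_i'. *)
Let prob_bad2 i i' j : i != i' -> i != j -> i' != j ->
  prob P (bad i j `&` bad i' j) = Q j ^+ 2.
Proof.
move=> ii' ij i'j.
pose C := [set w : n.-tuple V | A (dotp (tnth w i) (tnth w j))].
have mC : measurable C.
  by apply: measurable_dotp_preimage; exact: (@measurable_tnth _ V n).
have E : bad i j = forget X i' @^-1` C.
  by apply/seteqP; split => t; rewrite /bad /C/= !tnth_forget// eq_sym.
rewrite (bad_sym i') {1}E prob_forget// 1?eq_sym// -E prob_bad// (Q_eq i' j).
by rewrite expr2.
Qed.

Let prob_good_bad (i j : 'I_n) : (i < j)%N -> prob P (good j `&` bad i j) = prob P (good j) * Q j.
Proof.
move=> ij; have ij' : i != j by rewrite neq_ltn ij.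
pose C : set (n.-tuple V) := no_pair (fun k w => tnth w k) j.
have mC : measurable C by apply: measurable_no_pair; exact: (@measurable_tnth _ V n).
suff -> : good j = forget X j @^-1` C by exact: prob_forget.
apply/seteqP; split => t h k l kl lj; have := h k l kl lj.
  by rewrite !tnth_forget// neq_ltn ?lj// (ltn_trans kl lj).
by rewrite !tnth_forget// neq_ltn ?lj// (ltn_trans kl lj).
Qed.

Let near (j : 'I_n) (k : nat) : set T := [set t | exists2 i : 'I_n, (i < k)%N & bad i j t].

Let near0 j : near j 0 = set0.
Proof. by apply/seteqP; split => t // -[]. Qed.

Let nearS (j : 'I_n) k (kj : (k < j)%N) :
  near j k.+1 = near j k `|` bad (Ordinal (ltn_trans kj (ltn_ord j))) j.
Proof.
apply/seteqP; split => t.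
  move=> [i]; rewrite ltnS leq_eqVlt => /predU1P[ik|ik] b; last by left; exists i.
  by right; move: b; rewrite (_ : i = Ordinal (ltn_trans kj (ltn_ord j)))//; exact: val_inj.
move=> [[i ik b]|b]; first by exists i => //; exact: ltnW.
by exists (Ordinal (ltn_trans kj (ltn_ord j))) => /=.
Qed.

Let measurable_near j k : measurable (near j k).
Proof.
have -> : near j k = \bigcup_(i in [set i : 'I_n | (i < k)%N]) bad i j.
  by apply/seteqP; split => t [i ik b]; exists i.
by apply: fin_bigcup_measurable => //; exact: finite_finset.
Qed.

Let Q_ge0 j : 0 <= Q j. Proof. by rewrite fine_ge0. Qed.

Let prob_near_bad (i j : 'I_n) k : (k <= i)%N -> (i < j)%N ->
  prob P (near j k `&` bad i j) <= k%:R * Q j ^+ 2.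
Proof.
move=> + ij; elim: k => [_|k IH ki].
  by rewrite near0 set0I /prob measure0 mul0r.
rewrite (nearS (ltn_trans ki ij)) setIUl; set i' := Ordinal _.
have mnb : measurable (near j k `&` bad i j) by exact: measurableI.
have mbb : measurable (bad i' j `&` bad i j) by exact: measurableI.
rewrite (le_trans (prob_setU_le P mnb mbb))// -natr1 mulrDl mul1r lerD//.
  exact/IH/ltnW.
rewrite prob_bad2// neq_ltn/=; first by rewrite ki.
  by rewrite (ltn_trans ki ij).
by rewrite ij.
Qed.

(** Bonferroni with the pairs of X_j entering one by one. Removing the next [bad i j] costs P(good
    j) Q less its overlap with the k earlier events, and that overlap is at most k Q^2; these
    overlaps sum to at most k^2 Q^2. *)
Let prob_good_near (j : 'I_n) k : (k <= j)%N ->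
  0 <= prob P (good j `\` near j k) - prob P (good j) * (1 - k%:R * Q j)
    <= k%:R ^+ 2 * Q j ^+ 2.
Proof.
elim: k => [_|k IH kj].
  by rewrite near0 setD0 mul0r subr0 mulr1 subrr expr0n mul0r lexx.
have {IH}/andP[h1 h2] := IH (ltnW kj).
rewrite (nearS kj); set i := Ordinal _.
have mg := measurable_good j; have mn := measurable_near j k; have mb := measurable_bad i j.
have mgn : measurable (good j `\` near j k) by exact: measurableD.
have mgb : measurable (good j `&` bad i j) by exact: measurableI.
have mnb : measurable (near j k `&` bad i j) by exact: measurableI.
rewrite -setDDl probD//.
have -> : (good j `\` near j k) `&` bad i j = (good j `&` bad i j) `\` near j k.
  by apply/seteqP; split => t /=; tauto.
rewrite (probD P mgb mn) prob_good_bad//.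
have mgbn : measurable ((good j `&` bad i j) `&` near j k) by exact: measurableI.
have := prob_near_bad (leqnn i) kj.
have : prob P ((good j `&` bad i j) `&` near j k) <= prob P (near j k `&` bad i j).
  by apply: prob_le => // t [[_ ?] ?].
have := prob_ge0 P ((good j `&` bad i j) `&` near j k).
have kQ : 0 <= k%:R * Q j ^+ 2 by rewrite mulr_ge0// sqr_ge0.
have Q2 : 0 <= Q j ^+ 2 by rewrite sqr_ge0.
rewrite -natr1 /=; lra.
Qed.

Let goodS (j : 'I_n) : good j.+1 = good j `\` near j j.
Proof.
apply/seteqP; split => t.
  move=> h; split; first by move=> k l kl lj; apply: h => //; exact: ltnW.
  by move=> [i ij]; exact: h.
move=> [h hn] k l kl; rewrite ltnS leq_eqVlt => /predU1P[lj|lj]; last exact: h.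
have -> : l = j by exact: val_inj.
by move=> b; apply: hn; exists k => //; rewrite -lj.
Qed.

Lemma no_bad_pair_estimate (j : 'I_n) :
  let q := fine (distribution P (X j) [set y | A (tnth y c)]) in n%:R * q <= 1 ->
  `|prob P [set t | forall i j : 'I_n, (i < j)%N -> ~ A (dotp (X i t) (X j t))] -
    expR (- (q * (n%:R * (n%:R - 1) / 2)))| <= 2 * n%:R ^+ 3 * q ^+ 2.
Proof.
move=> q nq; have -> : [set t | forall i j : 'I_n, (i < j)%N ->
    ~ A (dotp (X i t) (X j t))] = good n.
  by apply/seteqP; split => t h k l kl; [move=> _; exact: h|exact: h].
apply: (@recursion_expR _ (fun m => prob P (good m))) => //; first exact: Q_ge0.
  rewrite (_ : good 0 = setT); first by rewrite /prob probability_setT.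
  by apply/seteqP; split.
move=> m mn; have := prob_good_near (leqnn (Ordinal mn)).
by rewrite -goodS (Q_eq (Ordinal mn) j).
Qed.

End no_bad_pair.

Section pair_law.
Context d (T : measurableType d) (R : realType) (P : probability T R).
Context (n p : nat) (X : 'I_n -> {RV P >-> p.-tuple R}).

(** The two hypotheses of [tail_cvg] on one tail F, with h in the role of H(0). *)
Definition mills_pair (p : nat) (h : R) (F : R -> R) :=
  (forall s s', 0 <= s -> s < s' -> s' < 1 ->
    h * Num.sqrt (1 - s ^+ 2) ^+ p.-1 - h * Num.sqrt (1 - s' ^+ 2) ^+ p.-1
      <= s' * F s) /\
  (forall s, 0 < s -> s < 1 -> s * F s <= h * Num.sqrt (1 - s ^+ 2) ^+ p.-1).

Definition avoids (A : set R) : set T :=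
  [set t | forall i j : 'I_n, (i < j)%N -> ~ A (dotp (X i t) (X j t))].

Lemma measurable_avoids A : measurable A -> measurable (avoids A).
Proof.
move=> mA; pose G (i j : 'I_n) := if (i < j)%N then
  ~` [set t | A (dotp (X i t) (X j t))] else setT.
have -> : avoids A = \bigcap_i \bigcap_j G i j.
  apply/seteqP; split => t h i; last first.
    by move=> j ij; have := h i I j I; rewrite /G ij.
  by move=> _ j _; rewrite /G; case: ifP => // ij; exact: h.
apply: fin_bigcap_measurable; first exact: finite_finset.
move=> i _; apply: fin_bigcap_measurable; first exact: finite_finset.
move=> j _; rewrite /G; case: ifP => // _; apply: measurableC.
rewrite -[X in measurable X]setTI.
by apply: (@measurable_dotp R p _ T (X i) (X j)) => //; exact: measurable_funPT.
Qed.

Hypothesis X_indep : mutually_independent X.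
Hypothesis X_unif : forall i, uniform_on_sphere (distribution P (X i)).

(** The law q and the moment h are quantified existentially because they are built on indices in
    ['I_n] and ['I_p] that exist only for n, p >= 2; this lets a sequence of them be chosen over all
    n. *)
Lemma pair_law : (2 <= n)%N -> (2 <= p)%N -> exists qh : (set R -> R) * R,
  [/\ [/\ 0 <= qh.2, 1 <= 2 * pi * p%:R * qh.2 ^+ 2 <= 1 + p%:R^-1,
        mills_pair p qh.2 (fun s => qh.1 `]s, +oo[%classic) &
        mills_pair p qh.2 (fun s => qh.1 `]-oo, - s]%classic)],
      forall a b, b < a ->
        qh.1 (`]a, +oo[%classic `|` `]-oo, b]%classic) =
        qh.1 `]a, +oo[%classic + qh.1 `]-oo, b]%classic,
      forall A, 0 <= qh.1 A &
      forall A, measurable A -> n%:R * qh.1 A <= 1 ->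
        `|prob P (avoids A) - expR (- (qh.1 A * (n%:R * (n%:R - 1) / 2)))|
          <= 2 * n%:R ^+ 3 * qh.1 A ^+ 2].
Proof.
move=> n2 p2; pose c : 'I_p := Ordinal (ltnW p2); pose j : 'I_n := Ordinal (ltnW n2).
pose nu := distribution P (X j); have nu_unif : uniform_on_sphere nu := X_unif j.
pose q (A : set R) := fine (nu [set y | A (tnth y c)]).
have mq A : measurable A -> measurable [set y : p.-tuple R | A (tnth y c)].
  exact: measurable_tnth_preimage.
have h0 : 0 <= cap_moment nu c 0 by exact: cap_moment_ge0.
have upper s : 0 < s -> s < 1 ->
    s * q `[s, +oo[%classic <= cap_moment nu c 0 * Num.sqrt (1 - s ^+ 2) ^+ p.-1.
  move=> s0 s1; rewrite -(cap_momentE nu_unif c (ltW s0) s1) /q set_itvcy.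
  exact: cap_moment_mills_upper.
have lower s s' : 0 <= s -> s < s' -> s' < 1 ->
    cap_moment nu c 0 * Num.sqrt (1 - s ^+ 2) ^+ p.-1 -
    cap_moment nu c 0 * Num.sqrt (1 - s' ^+ 2) ^+ p.-1 <= s' * q `]s, +oo[%classic.
  move=> s0 ss' s'1; rewrite -(cap_momentE nu_unif c s0 (lt_trans ss' s'1)).
  rewrite -(cap_momentE nu_unif c (le_trans s0 (ltW ss')) s'1) /q set_itvoy.
  exact: cap_moment_mills_lower.
have q_le s : q `]s, +oo[%classic <= q `[s, +oo[%classic.
  apply: (@prob_le _ _ _ nu); try exact: mq.
  by move=> y /=; rewrite !in_itv/= !andbT => /ltW.
have q_sym s : q `]-oo, - s]%classic = q `[s, +oo[%classic.
  pose e : p.-tuple R := [tuple (k == c)%:R | k < p].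
  have de y : dotp e y = tnth y c.
    rewrite /dotp (bigD1 c)//= tnth_mktuple eqxx mul1r big1 ?addr0// => k /negbTE kj.
    by rewrite tnth_mktuple kj mul0r.
  have := nu_unif.2 _ (orthogonal_reflection_mx e) _ (mq _ (measurable_itv `[s, +oo[)).
  rewrite mxact_reflection => E; apply: etrans (congr1 fine E); congr (fine (nu _)).
  apply/seteqP; split => y /=; rewrite tnth_reflection !de tnth_mktuple eqxx !in_itv/= andbT;
    rewrite divr1 mulr1n mulr1; lra.
have q0 A : 0 <= q A by rewrite /q fine_ge0.
exists (q, cap_moment nu c 0); split => //=.
- split => //; first exact: cap_moment0_sqr_bounds.
    split=> // s s0 s1; rewrite (le_trans _ (upper _ s0 s1))//.
    by rewrite ler_wpM2l// ltW.
  split=> [s s' s0 ss' s'1|s s0 s1]; last by rewrite q_sym upper.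
  rewrite (le_trans (lower _ _ s0 ss' s'1))// q_sym ler_wpM2l//.
  by rewrite (le_trans s0)// ltW.
- move=> a b ba; rewrite /q -fineD; last 2 first.
  + by apply: fin_num_measure; exact: mq.
  + by apply: fin_num_measure; exact: mq.
  congr fine; rewrite -measureU; last 3 first.
  + exact: mq.
  + exact: mq.
  + apply/seteqP; split => y //=; rewrite !in_itv/= andbT => -[]; lra.
  by congr (nu _).
- move=> A mA nq; exact: (@no_bad_pair_estimate _ _ _ _ _ _ X X_indep X_unif c A mA j nq).
Qed.

End pair_law.

(** * Poisson limit for the absence of bad pairs *)

Section poisson_limit.
Context (R : realType) (q : nat -> R) (lambda : R).
Hypothesis q_cvg : n%:R ^+ 2 * q n @[n --> \oo] --> lambda.

Let inv_cvg : n%:R^-1 @[n --> \oo] --> (0 : R).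
Proof.
apply/gtr0_cvgV0; last exact: cvgr_idn.
by near=> n; rewrite ltr0n; near: n; exact: nbhs_infty_gt.
Unshelve. all: by end_near. Qed.

Let expR_pairs_cvg :
  expR (- (q n * (n%:R * (n%:R - 1) / 2))) @[n --> \oo] --> expR (- (lambda / 2)).
Proof.
apply: continuous_cvg; first exact: continuous_expR.
apply: cvgN.
have -> : (fun n => q n * (n%:R * (n%:R - 1) / 2)) =
    (fun n => n%:R ^+ 2 * q n * (1 - n%:R^-1) / 2).
  apply/funext => -[|n]; first by rewrite expr0n !(mul0r, mulr0).
  by field.
have -> : lambda / 2 = lambda * (1 - 0) / 2 by rewrite subr0 mulr1.
apply: cvgMl; apply: cvgM => //; apply: cvgB => //; exact: cvg_cst.
Qed.

(** When n^2 q tends to lambda, q n (n - 1) / 2 tends to lambda / 2, n q tends to 0, and the error 2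
    n^3 q^2 = 2 (n^2 q)^2 / n vanishes. *)
Lemma poisson_cvg (a : nat -> R) : (forall n, 0 <= q n) ->
  (forall n, (2 <= n)%N -> n%:R * q n <= 1 ->
    `|a n - expR (- (q n * (n%:R * (n%:R - 1) / 2)))| <= 2 * n%:R ^+ 3 * q n ^+ 2) ->
  a n @[n --> \oo] --> expR (- (lambda / 2)).
Proof.
move=> q0 est.
have nq_cvg : n%:R ^+ 2 * q n * n%:R^-1 @[n --> \oo] --> lambda * 0 by exact: cvgM.
have err_cvg : 2 * (n%:R ^+ 2 * q n) * (n%:R ^+ 2 * q n) * n%:R^-1 @[n --> \oo] -->
    2 * lambda * lambda * 0.
  by apply: cvgM => //; apply: cvgM => //; apply: cvgMr.
rewrite !mulr0 in nq_cvg err_cvg.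
apply/cvgrPdist_le => e e0; have e2 : 0 < e / 2 by rewrite divr_gt0.
near=> n.
have n2 : (2 <= n)%N by near: n; exact: nbhs_infty_ge.
have n0 : n%:R != 0 :> R by rewrite pnatr_eq0 -lt0n (leq_trans _ n2).
have h1 : `|0 - n%:R ^+ 2 * q n * n%:R^-1| <= 1 by near: n; exact: cvgr_dist_le.
have h2 : `|0 - 2 * (n%:R ^+ 2 * q n) * (n%:R ^+ 2 * q n) * n%:R^-1| <= e / 2.
  by near: n; exact: cvgr_dist_le.
have h3 : `|expR (- (lambda / 2)) - expR (- (q n * (n%:R * (n%:R - 1) / 2)))| <= e / 2.
  by near: n; exact: cvgr_dist_le.
have E1 : n%:R ^+ 2 * q n * n%:R^-1 = n%:R * q n by field.
have E2 : 2 * (n%:R ^+ 2 * q n) * (n%:R ^+ 2 * q n) * n%:R^-1 = 2 * n%:R ^+ 3 * q n ^+ 2.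
  by field.
have nq1 : n%:R * q n <= 1.
  by move: h1; rewrite E1 sub0r normrN; apply: le_trans; exact: ler_norm.
have := est n n2 nq1; move: h2 h3; rewrite E2 sub0r normrN.
move=> /(le_trans (ler_norm _)); rewrite !ler_norml; lra.
Unshelve. all: by end_near. Qed.

End poisson_limit.

(** * The extreme angles *)

Section angles.
Context (R : realType).

Lemma cos_nincr (x y : R) : 0 <= x -> x <= y -> y <= pi -> cos y <= cos x.
Proof.
move=> x0 xy yp; rewrite leNgt ltr_cos ?in_itv/=.
- by rewrite -leNgt.
- by rewrite yp (le_trans x0).
- by rewrite x0 (le_trans xy).
Qed.

(* Outside [[-1, 1]] the library's [acos] is a junk constant. *)
Lemma measurable_acos : measurable_fun setT (@acos R).
Proof.
pose clip (x : R) := Num.max (-1) (Num.min x 1).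
have clip_range x : -1 <= clip x <= 1.
  by rewrite /clip le_max lexx/= ge_max ge_min lexx orbT andbT; lra.
have clip_id x : -1 <= x <= 1 -> clip x = x.
  by move=> /andP[x0 x1]; rewrite /clip min_l// max_r.
have clip_homo x y : x <= y -> clip x <= clip y.
  move=> xy; rewrite /clip ge_max le_max lexx/= le_max; apply/orP; right.
  by rewrite le_min !ge_min xy lexx orbT.
have acos_clip : nonincreasing_fun (@acos R \o clip).
  move=> x y xy /=; rewrite leNgt; apply/negP => h.
  have := clip_homo _ _ xy; rewrite -(acosK (_ : clip y \in `[-1, 1])) ?in_itv//=.
  rewrite -(acosK (_ : clip x \in `[-1, 1])) ?in_itv//= leNgt => /negP; apply.
  by rewrite ltr_cos ?in_itv/= ?acos_ge0 ?acos_lepi.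
have -> : @acos R = fun x => if (-1 <= x) && (x <= 1) then (acos \o clip) x
    else get (set0 : set R).
  apply/funext => x; case: ifPn => [x1|x1]; first by rewrite /= clip_id.
  rewrite acos.unlock; congr get; apply/seteqP; split => y // -[_ yx].
  by move: x1; rewrite -yx cos_geN1 cos_le1.
apply: measurable_fun_ifT => //; last exact: nonincreasing_measurable.
by apply: measurable_and; apply: measurable_fun_ler.
Qed.

Section unit_vectors.
Context (n p : nat) (x : 'I_n -> p.-tuple R).
Hypothesis x_unit : forall i, unit_sphere (x i).

Lemma dotp_unit_bounds i j : -1 <= dotp (x i) (x j) <= 1.
Proof.
have [xi xj] := (x_unit i, x_unit j); rewrite unit_sphereE/= in xi xj.
have h (e : R) : e ^+ 2 = 1 -> 0 <= 2 + 2 * e * dotp (x i) (x j).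
  move=> e2; have -> : 2 + 2 * e * dotp (x i) (x j) =
      \sum_(k < p) (tnth (x i) k + e * tnth (x j) k) ^+ 2.
    transitivity (dotp (x i) (x i) + e ^+ 2 * dotp (x j) (x j) + 2 * e * dotp (x i) (x j)).
      by rewrite xi xj e2 mulr1.
    rewrite /dotp !mulr_sumr -!big_split/=; apply: eq_bigr => k _; ring.
  by apply: sumr_ge0 => k _; exact: sqr_ge0.
have := h 1 (expr1n _ _).
have : 0 <= 2 + 2 * -1 * dotp (x i) (x j) by apply: h; rewrite sqrrN expr1n.
by move=> ? ?; apply/andP; split; lra.
Qed.

Let angle_range i j : 0 <= angle (x i) (x j) <= pi.
Proof. by rewrite acos_ge0 ?acos_lepi// dotp_unit_bounds. Qed.

Let cos_angle i j : cos (angle (x i) (x j)) = dotp (x i) (x j).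
Proof. by rewrite acosK// in_itv/= dotp_unit_bounds. Qed.

(** cos decreases on [0, pi]. The bound on s takes care of the default value pi, whose cosine is
    -1. *)
Lemma cos_Theta_min_le (s : R) : -1 <= s ->
  (cos (Theta_min x) <= s) <-> forall i j : 'I_n, (i < j)%N -> dotp (x i) (x j) <= s.
Proof.
move=> s1; split => [h i j ij|h].
  rewrite (le_trans _ h)// -cos_angle; apply: cos_nincr.
  - rewrite /Theta_min; elim/big_ind: _ => [|a b a0 b0|kl _]; first exact: pi_ge0.
      by rewrite le_min a0.
    by have /andP[] := angle_range kl.1 kl.2.
  - exact: (@bigmin_le_cond _ _ _ _ (i, j)).
  - by have /andP[] := angle_range i j.
rewrite /Theta_min; elim/big_ind: _ => [|a b a0 b0|kl kl_lt].
- by rewrite cospi.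
- by rewrite /Num.min; case: ifP.
- by rewrite cos_angle h.
Qed.

(** Here s < 1 excludes the default value 0, whose cosine is 1, so the maximum is attained at an
    actual pair. *)
Lemma cos_Theta_max_le (s : R) : s < 1 ->
  (cos (Theta_max x) <= s) <-> exists i j : 'I_n, (i < j)%N /\ dotp (x i) (x j) <= s.
Proof.
move=> s1; split => [|[i [j [ij h]]]].
  apply: contraPP => /forallNP h; apply/negP; rewrite -ltNge.
  rewrite /Theta_max; elim/big_ind: _ => [|a b a0 b0|kl kl_lt].
  - by rewrite cos0.
  - by rewrite /Num.max; case: ifP.
  - rewrite cos_angle ltNge; apply/negP => hk.
    by apply: (h kl.1); exists kl.2.
rewrite (le_trans _ h)// -cos_angle; apply: cos_nincr.
- by have /andP[] := angle_range i j.
- exact: (@le_bigmax_cond _ _ _ _ (i, j)).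
- rewrite /Theta_max; elim/big_ind: _ => [|a b a0 b0|kl _]; first exact: pi_ge0.
    by rewrite ge_max a0.
  by have /andP[] := angle_range kl.1 kl.2.
Qed.

End unit_vectors.

Lemma measurable_Theta_min d (T : measurableType d) (n p : nat)
    (X : 'I_n -> T -> p.-tuple R) : (forall i, measurable_fun setT (X i)) ->
  measurable_fun setT (fun t => Theta_min (fun i => X i t)).
Proof.
move=> mX; rewrite /Theta_min; elim: (index_enum _) => [|ij s IH].
  by under eq_fun do rewrite big_nil; exact: measurable_cst.
under eq_fun do rewrite big_cons; case: (ij.1 < ij.2)%N => //.
apply: measurable_minr => //.
by apply: (measurableT_comp measurable_acos); exact: measurable_dotp.
Qed.

Lemma measurable_Theta_max d (T : measurableType d) (n p : nat)
    (X : 'I_n -> T -> p.-tuple R) : (forall i, measurable_fun setT (X i)) ->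
  measurable_fun setT (fun t => Theta_max (fun i => X i t)).
Proof.
move=> mX; rewrite /Theta_max; elim: (index_enum _) => [|ij s IH].
  by under eq_fun do rewrite big_nil; exact: measurable_cst.
under eq_fun do rewrite big_cons; case: (ij.1 < ij.2)%N => //.
apply: measurable_maxr => //.
by apply: (measurableT_comp measurable_acos); exact: measurable_dotp.
Qed.

End angles.

(** * The joint distribution function *)

Section joint_limit.
Context (R : realType) (p : nat -> nat).
Hypothesis hp : forall n, (2 <= n)%N -> (2 <= p n)%N.
Context (d : nat -> measure_display) (T : forall n, measurableType (d n)).
Context (P : forall n, probability (T n) R).
Context (X : forall n, 'I_n -> {RV (P n) >-> (p n).-tuple R}).
Arguments X : clear implicits.
Hypothesis X_indep : forall n, (2 <= n)%N -> mutually_independent (X n).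
Hypothesis X_unif : forall n, (2 <= n)%N -> forall i : 'I_n,
  uniform_on_sphere (distribution (P n) (X n i)).
Hypothesis p_infty : p n @[n --> \oo] --> \oo.

Let Cmin n (w : T n) : R := C_min (fun i : 'I_n => X n i w).
Let Cmax n (w : T n) : R := C_max (fun i : 'I_n => X n i w).

Let mX n i : measurable_fun setT (X n i : T n -> (p n).-tuple R).
Proof. exact: measurable_funPT. Qed.

Lemma measurable_C_min n : measurable_fun setT (@Cmin n).
Proof.
apply: measurable_funD => //; apply: measurable_funM => //; apply: measurable_funB => //.
apply: (measurableT_comp (f := @cos R)); last exact: measurable_Theta_min.
by apply: continuous_measurable_fun => z; exact: continuous_cos.
Qed.

Lemma measurable_C_max n : measurable_fun setT (@Cmax n).
Proof.
apply: measurable_funB => //; apply: measurable_funM => //; apply: measurable_funD => //.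
apply: (measurableT_comp (f := @cos R)); last exact: measurable_Theta_max.
by apply: continuous_measurable_fun => z; exact: continuous_cos.
Qed.

Let NE n : (2 <= n)%N -> (p n)%:R - 1 = (p n).-1%:R :> R.
Proof. by move=> n2; rewrite -[in LHS](ltn_predK (hp n2)) -natr1 addrK. Qed.

Let alphat_gt0 n : (2 <= n)%N -> 0 < alpha_ R n (p n) * t_ R n (p n).
Proof.
move=> n2; have N0 : 0 < (p n).-1%:R :> R by rewrite ltr0n -ltnS (ltn_predK (hp n2)) hp.
have t0 : 0 < t_ R n (p n) by exact: expR_gt0.
rewrite mulr_gt0// divr_gt0// NE// !mulr_gt0// sqrtr_gt0 subr_gt0 exprn_ilt1 ?ltW//.
rewrite /t_ -[ltRHS](@expR0 R) ltr_expR NE// oppr_lt0 divr_gt0// mulr_gt0//.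
by rewrite ln_gt0// ltr1n.
Qed.

Let C_min_le n w z : (2 <= n)%N ->
  (Cmin (n := n) w <= z) = (cos (Theta_min (fun i => X n i w)) <= @threshold R p n z).
Proof.
move=> n2; rewrite /Cmin /C_min /threshold NE//.
by rewrite -lerBrDr div1r ler_pdivrMl ?alphat_gt0// lerBlDl.
Qed.

Let C_max_le n w z : (2 <= n)%N ->
  (Cmax (n := n) w <= z) = (cos (Theta_max (fun i => X n i w)) <= - @threshold R p n (- z)).
Proof.
move=> n2; rewrite /Cmax /C_max /threshold NE//.
rewrite lerBlDr div1r ler_pdivrMl ?alphat_gt0//.
rewrite -lerBrDr; congr (_ <= _); ring.
Qed.

Let A1 n z : set R := `]@threshold R p n z, +oo[%classic.
Let A2 n z : set R := A1 n z.1 `|` `]-oo, - @threshold R p n (- z.2)]%classic.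

Let joint_cdfE n z : (2 <= n)%N -> 0 < @threshold R p n z.1 ->
  0 < @threshold R p n (- z.2) ->
  joint_cdf (P n) (@Cmin n) (@Cmax n) z =
  prob (P n) (avoids (X n) (A1 n z.1)) - prob (P n) (avoids (X n) (A2 n z)).
Proof.
move=> n2 s10 s20; set s1 := @threshold R p n z.1 in s10; set s2 := @threshold R p n (- z.2) in s20.
have mA1 : measurable (A1 n z.1) by exact: measurable_itv.
have mA2 : measurable (A2 n z) by apply: measurableU => //; exact: measurable_itv.
have mE1 := measurable_avoids (X n) mA1; have mE2 := measurable_avoids (X n) mA2.
have sub : avoids (X n) (A2 n z) `<=` avoids (X n) (A1 n z.1).
  by move=> t h i j ij a; apply: (h i j ij); left.
have -> : prob (P n) (avoids (X n) (A2 n z)) =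
    prob (P n) (avoids (X n) (A1 n z.1) `&` avoids (X n) (A2 n z)).
  by congr (prob _ _); apply/seteqP; split => t; [move=> h; split => //; exact: sub|case].
rewrite -probD// /joint_cdf /prob; congr fine.
(* Angles translate into scalar products on unit vectors only, so both events are intersected with
   the almost sure event [S]; for the event on angles this relies on the measurability of [C_min]
   and [C_max]. *)
pose S := \bigcap_(i in [set: 'I_n]) (X n i @^-1` @unit_sphere R (p n)).
have mSi i : measurable (X n i @^-1` @unit_sphere R (p n)).
  rewrite -[X in measurable X]setTI; apply: mX => //.
  exact: measurable_unit_sphere.
have mS : measurable S by apply: fin_bigcap_measurable; [exact: finite_finset|].
have PS : P n S = 1%E.
  have -> : S = \bigcap_(i in [set` [set: 'I_n]%SET]) (X n i @^-1` @unit_sphere R (p n)).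
    by apply/seteqP; split => t h i _; apply: h => //; rewrite /= inE.
  rewrite (X_indep n2) => [|i]; last exact: measurable_unit_sphere.
  by apply: big1 => i _; exact: (X_unif n2 i).1.
have mE : measurable [set w | Cmin w <= z.1 /\ Cmax (n := n) w <= z.2].
  have -> : [set w | Cmin w <= z.1 /\ Cmax (n := n) w <= z.2] =
    (@Cmin n @^-1` `]-oo, z.1]%classic) `&` (@Cmax n @^-1` `]-oo, z.2]%classic).
    by apply/seteqP; split => w /=; rewrite !in_itv/=.
  apply: measurableI; rewrite -[X in measurable X]setTI.
    by apply: measurable_C_min => //; exact: measurable_itv.
  by apply: measurable_C_max => //; exact: measurable_itv.
rewrite -(probability1_setI mS mE PS) -(probability1_setI mS (measurableD mE1 mE2) PS).
have s1N : -1 <= s1 by lra.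
have s2N : - s2 < 1 by lra.
congr (P n _); apply/seteqP; split => w [Sw] /=.
  rewrite C_min_le// C_max_le// => -[].
  have Sx i : unit_sphere (X n i w) := Sw i I.
  move=> /(cos_Theta_min_le Sx s1N) h1 /(cos_Theta_max_le Sx s2N)[i [j [ij h2]]].
  split => //; split => [k l kl|].
    by rewrite /A1 /= in_itv/= andbT; apply/negP; rewrite -leNgt; exact: h1.
  by move=> /(_ i j ij); apply; right; rewrite /= in_itv/=.
rewrite C_min_le// C_max_le// => -[h1 h2].
have Sx i : unit_sphere (X n i w) := Sw i I.
split => //; split.
  apply/(cos_Theta_min_le Sx s1N) => i j ij.
  by rewrite leNgt; apply/negP => h; apply: (h1 i j ij); rewrite /A1/= in_itv/= h.
apply/(cos_Theta_max_le Sx s2N).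
apply: contrapT => /forallNP h; apply: h2 => i j ij [].
  exact: h1.
by rewrite /= in_itv/= => hij; apply: (h i); exists j.
Qed.

Lemma joint_cdf_cvg z : joint_cdf (P n) (@Cmin n) (@Cmax n) z @[n --> \oo] -->
  expR (- (cap_rate z.1 / 2)) - expR (- ((cap_rate z.1 + cap_rate (- z.2)) / 2)).
Proof.
have ex n : exists qh : (set R -> R) * R, (forall A, 0 <= qh.1 A) /\ ((2 <= n)%N ->
   [/\ [/\ 0 <= qh.2, 1 <= 2 * pi * (p n)%:R * qh.2 ^+ 2 <= 1 + (p n)%:R^-1,
        mills_pair (p n) qh.2 (fun s => qh.1 `]s, +oo[%classic) &
        mills_pair (p n) qh.2 (fun s => qh.1 `]-oo, - s]%classic)],
      forall a b, b < a -> qh.1 (`]a, +oo[%classic `|` `]-oo, b]%classic) =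
        qh.1 `]a, +oo[%classic + qh.1 `]-oo, b]%classic &
      forall A, measurable A -> n%:R * qh.1 A <= 1 ->
        `|prob (P n) (avoids (X n) A) - expR (- (qh.1 A * (n%:R * (n%:R - 1) / 2)))|
          <= 2 * n%:R ^+ 3 * qh.1 A ^+ 2]).
  (* Below n = 2 only nonnegativity is asked, and the zero function provides it. *)
  have [n2|n2] := leqP 2 n; last by exists (fun=> 0, 0); split.
  by have [qh [h1 h2 h3 h4]] := pair_law (X_indep n2) (X_unif n2) n2 (hp n2); exists qh.
have [qh qhP] := choice ex.
pose q n := (qh n).1; pose h n := (qh n).2.
have q0 n A : 0 <= q n A := (qhP n).1 A.
have qP n (n2 : (2 <= n)%N) := (qhP n).2 n2.
have h0 n : (2 <= n)%N -> 0 <= h n by move=> /qP[[]].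
have hb n : (2 <= n)%N -> 1 <= 2 * pi * (p n)%:R * h n ^+ 2 <= 1 + (p n)%:R^-1.
  by move=> /qP[[]].
have up y : n%:R ^+ 2 * q n `](@threshold R p n y), +oo[%classic @[n --> \oo] --> cap_rate y.
  apply: (@tail_cvg R p hp p_infty h (fun n s => q n `]s, +oo[%classic)) => //.
    by move=> n s s' /qP[[_ _ [m _] _] _ _]; exact: m.
  by move=> n s /qP[[_ _ [_ m] _] _ _]; exact: m.
have low y : n%:R ^+ 2 * q n `]-oo, (- @threshold R p n y)]%classic @[n --> \oo] --> cap_rate y.
  apply: (@tail_cvg R p hp p_infty h (fun n s => q n `]-oo, - s]%classic)) => //.
    by move=> n s s' /qP[[_ _ _ [m _]] _ _]; exact: m.
  by move=> n s /qP[[_ _ _ [_ m]] _ _]; exact: m.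
have q1_cvg : n%:R ^+ 2 * q n (A1 n z.1) @[n --> \oo] --> cap_rate z.1 by exact: up.
(* Positive thresholds make the two half-lines disjoint, so their rates add; the product form of the
   limit rests on this. *)
have q2_cvg : n%:R ^+ 2 * q n (A2 n z) @[n --> \oo] --> cap_rate z.1 + cap_rate (- z.2).
  apply: cvg_trans (cvgD (up z.1) (low (- z.2))); apply: near_eq_cvg; near=> n.
  have n2 : (2 <= n)%N by near: n; exact: nbhs_infty_ge.
  have /andP[a0 _] : 0 < @threshold R p n z.1 < 1 by near: n; exact: threshold_range_near.
  have /andP[b0 _] : 0 < @threshold R p n (- z.2) < 1.
    by near: n; exact: threshold_range_near.
  have [_ qU _] := qP n n2; rewrite /A2 /A1 /q qU; last by lra.
  by rewrite mulrDr.
have c1 := poisson_cvg q1_cvg (a := fun n => prob (P n) (avoids (X n) (A1 n z.1))).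
have c2 := poisson_cvg q2_cvg (a := fun n => prob (P n) (avoids (X n) (A2 n z))).
have {}c1 := c1 (fun n => q0 n _)
  (fun n n2 => let: And3 _ _ e := qP n n2 in e _ (measurable_itv _)).
have mA2 n : measurable (A2 n z) by apply: measurableU; exact: measurable_itv.
have {}c2 := c2 (fun n => q0 n _)
  (fun n n2 => let: And3 _ _ e := qP n n2 in e _ (mA2 n)).
apply: cvg_trans (cvgB c1 c2); apply: near_eq_cvg; near=> n.
rewrite joint_cdfE//.
- by near: n; exact: nbhs_infty_ge.
- have /andP[] // : 0 < @threshold R p n z.1 < 1 by near: n; exact: threshold_range_near.
- have /andP[] // : 0 < @threshold R p n (- z.2) < 1 by near: n; exact: threshold_range_near.
Unshelve. all: by end_near. Qed.

End joint_limit.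

(** * The limit law *)

Section D_cdf_cumulative.
Context (R : realType).

Let kappa : R := 1 / (2 * Num.sqrt (2 * pi)).

Let kappa_gt0 : 0 < kappa.
Proof. by rewrite divr_gt0// mulr_gt0// sqrtr_gt0 mulr_gt0// pi_gt0. Qed.

Lemma cap_rate_half (z : R) : cap_rate z / 2 = kappa * expR (- z / 2).
Proof.
have pi0 := pi_gt0 R; have tp0 : 0 < 2 * pi :> R by rewrite mulr_gt0.
have -> : cap_rate z = expR (- z / 2) / Num.sqrt (2 * pi).
  rewrite /cap_rate sqrtrM ?expR_ge0// sqrtrV ?(ltW tp0)//; congr (_ / _).
  rewrite -[in LHS](divfK (_ : 2 != 0) (- z)) ?pnatr_eq0// mulrC expRM_natl.
  by rewrite sqrtr_sqr ger0_norm// expR_ge0.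
by rewrite /kappa; field; rewrite gt_eqF// sqrtr_gt0.
Qed.

Lemma D_cdf_cap_rate (z : R) : D_cdf z = 1 - expR (- (cap_rate (- z) / 2)).
Proof. by rewrite cap_rate_half opprK. Qed.

Lemma D_cdf_nd : nondecreasing (@D_cdf R).
Proof.
by move=> x y xy; rewrite lerD2l lerN2 ler_expR lerN2 ler_pM2l// ler_expR ler_pM2r.
Qed.

Lemma continuous_D_cdf : continuous (@D_cdf R).
Proof.
move=> x; apply: cvgB; first exact: cvg_cst.
apply: (@continuous_comp _ _ _ (fun x : R => - (kappa * expR (x / 2))) expR).
  apply: cvgN; apply: cvgMr.
  apply: (@continuous_comp _ _ _ (fun x : R => x / 2) expR).
    by apply: cvgMl; exact: cvg_id.
  exact: continuous_expR.
exact: continuous_expR.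
Qed.

Lemma D_cdf_Ny : D_cdf x @[x --> -oo] --> (0 : R).
Proof.
apply/cvgrPdist_le => e e0; near=> x.
have x0 : x < 0 by near: x; apply: nbhs_ninfty_lt; exact: num_real.
have xe : x <= - (2 * kappa / e) by near: x; apply: nbhs_ninfty_le; exact: num_real.
have D0 : 0 <= D_cdf x.
  by rewrite subr_ge0 -[leRHS]expR0 ler_expR oppr_le0 mulr_ge0 ?expR_ge0 ?(ltW kappa_gt0).
rewrite sub0r normrN ger0_norm//; apply: (@le_trans _ _ (kappa * expR (x / 2))).
  by rewrite lerBlDr -lerBlDl expR_ge1Dx.
have y0 : 0 < - x / 2 by lra.
apply: (@le_trans _ _ (kappa / (- x / 2))).
  rewrite ler_pM2l// -[x / 2]opprK expRN lef_pV2 ?posrE ?expR_gt0//.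
  by have := expR_ge1Dx (- (x / 2)); lra.
rewrite ler_pdivrMr//; have : 2 * kappa / e * e <= - x * e by rewrite ler_pM2r//; lra.
by rewrite divfK ?gt_eqF//; lra.
Unshelve. all: by end_near. Qed.

Lemma D_cdf_y : D_cdf x @[x --> +oo] --> (1 : R).
Proof.
apply/cvgrPdist_le => e e0; near=> x.
have x0 : 0 < x by near: x; apply: nbhs_pinfty_gt; exact: num_real.
have xe : 2 / (kappa * e) <= x by near: x; apply: nbhs_pinfty_ge; exact: num_real.
rewrite /D_cdf -/kappa subKr ger0_norm ?expR_ge0// expRN.
have y0 : 0 < kappa * (x / 2) by rewrite mulr_gt0// divr_gt0.
apply: (@le_trans _ _ (kappa * (x / 2))^-1).
  rewrite lef_pV2 ?posrE ?expR_gt0//.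
  have h : kappa * (x / 2) <= kappa * expR (x / 2).
    by rewrite ler_pM2l//; have := expR_ge1Dx (x / 2); lra.
  by have := expR_ge1Dx (kappa * expR (x / 2)); lra.
rewrite -[leRHS]invrK lef_pV2 ?posrE ?invr_gt0//.
have ke : 0 < kappa * e by rewrite mulr_gt0.
rewrite -[leLHS]mul1r ler_pdivrMr//; move: xe; rewrite ler_pdivrMr//; lra.
Unshelve. all: by end_near. Qed.

HB.instance Definition _ := isCumulative.Build R _ R (@D_cdf R) D_cdf_nd
  (right_continuousW continuous_D_cdf).
HB.instance Definition _ := isCumulativeBounded.Build R 0 1 (@D_cdf R) D_cdf_Ny D_cdf_y.

End D_cdf_cumulative.

Section limit_space.
Context (R : realType).

Let mu : probability (measurableTypeR R) R :=
  lebesgue_stieltjes_measure (@D_cdf R : cumulativeBounded (0 : R) (1 : R)).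

Let mu_itvNyc (x : R) : mu `]-oo, x]%classic = (D_cdf x)%:E.
Proof. exact: (cdf_lebesgue_stieltjes_id (@D_cdf R : cumulativeBounded (0 : R) (1 : R))). Qed.

(** The law has no atoms, by continuity of [D_cdf]. This is used for - Z1 <= z, whose complement is
    the open condition Z1 < - z. *)
Let mu_itvNyo (x : R) : mu `]-oo, x[%classic = (D_cdf x)%:E.
Proof.
have mx (i : interval R) : measurable ([set` i] : set (measurableTypeR R)) by exact: measurable_itv.
have fx : mu `]-oo, x[%classic \is a fin_num by exact: fin_num_measure.
rewrite -(fineK fx); congr EFin; apply/eqP; rewrite eq_le; apply/andP; split.
  rewrite -lee_fin fineK// -mu_itvNyc le_measure ?inE//.
  by move=> y /=; rewrite !in_itv/= => /ltW.
apply/ler_addgt0Pr => e e0.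
have /cvgrPdist_le/(_ e e0) := @continuous_D_cdf R x; rewrite nearE => -[r /= r0 hr].
have := hr (x - r / 2).
rewrite /ball_/= opprB addrC subrK gtr0_norm ?divr_gt0// => /(_ _)/wrap[]; first lra.
rewrite ler_norml => /andP[_].
have : D_cdf (x - r / 2) <= fine (mu `]-oo, x[%classic).
  rewrite -lee_fin fineK// -mu_itvNyc le_measure ?inE//.
  by move=> y /=; rewrite !in_itv/= => ?; lra.
lra.
Qed.

Let Q : probability (measurableTypeR R * measurableTypeR R)%type R := (mu \x mu)%E.

Let QX (A B : set (measurableTypeR R)) : measurable A -> measurable B ->
  Q (A `*` B) = (mu A * mu B)%E.
Proof. by move=> mA mB; exact: product_measure1E. Qed.

(** Z1 and Z2 are the coordinates of a product space. [W] packs - Z1 as a random variable, the form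
    in which [asymptotically_independent] takes it. The last clause is the product exp(- a / 2) (1 -
    exp(- b / 2)) of the two marginals, expanded, with a and b the two values of [cap_rate]. *)
Lemma limit_space : exists (d' : measure_display) (S : measurableType d')
    (Q : probability S R) (W Z1 Z2 : {RV Q >-> R}),
  [/\ (forall w, W w = - Z1 w), independent2 W Z2 /\ independent2 Z1 Z2,
    (forall x, cdf Z1 x = (D_cdf x)%:E), (forall x, cdf Z2 x = (D_cdf x)%:E) &
    forall z : R * R, joint_cdf Q W Z2 z =
      expR (- (cap_rate z.1 / 2)) - expR (- ((cap_rate z.1 + cap_rate (- z.2)) / 2))].
Proof.
have m1 : measurable_fun setT (fst : measurableTypeR R * measurableTypeR R -> R).
  exact: measurable_fst.
have m2 : measurable_fun setT (snd : measurableTypeR R * measurableTypeR R -> R).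
  exact: measurable_snd.
have mN : measurable_fun setT (fun w : measurableTypeR R * measurableTypeR R => - w.1 : R).
  exact: measurable_funN.
pose Z1 : {RV Q >-> R} := HB.pack (fst : measurableTypeR R * measurableTypeR R -> R)
  (isMeasurableFun.Build _ _ _ _ _ m1).
pose Z2 : {RV Q >-> R} := HB.pack (snd : measurableTypeR R * measurableTypeR R -> R)
  (isMeasurableFun.Build _ _ _ _ _ m2).
pose W : {RV Q >-> R} := HB.pack (fun w : measurableTypeR R * measurableTypeR R => - w.1 : R)
  (isMeasurableFun.Build _ _ _ _ _ mN).
exists _, _, Q, W, Z1, Z2.
have mNA (A : set R) : measurable A -> measurable [set x : measurableTypeR R | A (- x)].
  move=> mA; rewrite -[X in measurable X]setTI.
  by have := @oppr_measurable R setT; apply.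
have mT : measurable (setT : set (measurableTypeR R)) by exact: measurableT.
have E1 (A : set R) : measurable A -> Q (Z1 @^-1` A) = mu A.
  move=> mA; transitivity (Q (A `*` setT)); last by rewrite QX// probability_setT mule1.
  by congr (Q _); apply/seteqP; split => w //= -[].
have E2 (A : set R) : measurable A -> Q (Z2 @^-1` A) = mu A.
  move=> mA; transitivity (Q (setT `*` A)); last by rewrite QX// probability_setT mul1e.
  by congr (Q _); apply/seteqP; split => w //= -[].
have EW (A : set R) : measurable A -> Q (W @^-1` A) = mu [set x : measurableTypeR R | A (- x)].
  move=> mA; transitivity (Q ([set x : measurableTypeR R | A (- x)] `*` setT)).
    by congr (Q _); apply/seteqP; split => w //= -[].
  by rewrite QX ?probability_setT ?mule1//; exact: mNA.
have EW2 (A B : set R) : measurable A -> measurable B ->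
    Q (W @^-1` A `&` Z2 @^-1` B) = (mu [set x : measurableTypeR R | A (- x)%R] * mu B)%E.
  by move=> mA mB; rewrite -QX//; exact: mNA.
split => //.
- split=> A B mA mB; first by rewrite EW2// EW// E2.
  by rewrite E1// E2// -QX.
- by move=> x; rewrite -mu_itvNyc; apply: E1; exact: measurable_itv.
- by move=> x; rewrite -mu_itvNyc; apply: E2; exact: measurable_itv.
move=> z; rewrite /joint_cdf.
have -> : [set w | W w <= z.1 /\ Z2 w <= z.2] =
    W @^-1` `]-oo, z.1]%classic `&` Z2 @^-1` `]-oo, z.2]%classic.
  by apply/seteqP; split => w /=; rewrite !in_itv.
rewrite EW2; [|exact: measurable_itv|exact: measurable_itv].
have -> : [set x : measurableTypeR R | `]-oo, z.1]%classic (- x)] = ~` `]-oo, (- z.1)[%classic.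
  apply/seteqP; split => x /=; rewrite !in_itv/=.
    by move=> h; apply/negP; rewrite -leNgt; lra.
  by move=> /negP; rewrite -leNgt; lra.
have mi : measurable (`]-oo, (- z.1)[%classic : set (measurableTypeR R)) by exact: measurable_itv.
rewrite probability_setC// mu_itvNyo mu_itvNyc -EFinB -EFinM/=.
rewrite !D_cdf_cap_rate opprK subKr mulrBr mulr1 -expRD; congr (_ - expR _).
ring.
Qed.

End limit_space.

Theorem theorem2p2 (R : realType) (p : nat -> nat)
    (hp : forall n, (2 <= n)%N -> (2 <= p n)%N)
    (d : nat -> measure_display) (T : forall n, measurableType (d n))
    (P : forall n, probability (T n) R)
    (X : forall n, 'I_n -> {RV (P n) >-> (p n).-tuple R})
    (X_indep : forall n, (2 <= n)%N -> mutually_independent (X n))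
    (X_unif : forall n, (2 <= n)%N -> forall i : 'I_n,
       uniform_on_sphere (distribution (P n) (X n i)))
    (p_infty : p n @[n --> \oo] --> \oo) :
  let Cmin := fun n (w : T n) => C_min (fun i : 'I_n => X n i w) in
  let Cmax := fun n (w : T n) => C_max (fun i : 'I_n => X n i w) in
  asymptotically_independent P Cmin Cmax /\
  exists (d' : measure_display) (S : measurableType d')
    (Q : probability S R) (Z1 Z2 : {RV Q >-> R}),
    [/\ independent2 Z1 Z2,
        forall x : R, cdf Z1 x = (D_cdf x)%:E,
        forall x : R, cdf Z2 x = (D_cdf x)%:E &
        cvg_in_distribution2 P Cmin Cmax Q (fun w => - Z1 w) Z2].
Proof.
move=> Cmin Cmax; have [d' [S [Q [W [Z1 [Z2 [WE [indW indZ] cdf1 cdf2 J]]]]]]] := limit_space R.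
have cvgW : cvg_in_distribution2 P Cmin Cmax Q W Z2.
  by move=> z _; rewrite J; exact: joint_cdf_cvg.
split; first by exists d', S, Q, W, Z2.
exists d', S, Q, Z1, Z2; split => //.
by have -> : (fun w => - Z1 w) = W by apply/funext => w; rewrite WE.
Qed.
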